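(* Let $X$ be a multivariate regularly varying random vector in $[0,\infty)^d$ with tail index $\alpha\in(0,\infty)$ and identically distributed margins $X^{(i)}\sim F$, $i=1,\dots,d$. Let $Y$ be a random vector with independent margins $Y^{(i)}\sim F$, $i=1,\dots,d$, and let $Z$ be a random vector with totally dependent margins, i.e. $Z^{(i)}=Z^{(1)}$ almost surely for $i=1,\dots,d$, and $Z^{(1)}\sim F$. Then (a) $Y\preceq_{\mathrm{apl}}X\preceq_{\mathrm{apl}}Z$ for $\alpha\ge 1$; (b) $Z\preceq_{\mathrm{apl}}X\preceq_{\mathrm{apl}}Y$ for $\alpha\in(0,1]$.
   Context: $x^{(i)}$ denotes the $i$-th component of a vector $x$; $\Sigma^d:=\{\xi\in[0,\infty)^d:\sum_i\xi^{(i)}=1\}$. Asymptotic portfolio loss order: for random vectors $X,Y$ in $\mathbb{R}^d$, $X\preceq_{\mathrm{apl}}Y$ means that for all $\xi\in\Sigma^d$, $\limsup_{t\to\infty}\frac{P\{\xi^{\top}X>t\}}{P\{\xi^{\top}Y\ge t\}}\le 1$, where $\frac00:=1$ (and $a/0=+\infty$ for $a>0$). Multivariate regular variation: $X$ in $\mathbb{R}^d$ is multivariate regularly varying with tail index $\alpha\in(0,\infty)$ if there exist a sequence $a_n\to\infty$ and a non-zero Radon measure $\nu$ on the Borel sets of $[-\infty,\infty]^d\setminus\{0\}$ with $\nu([-\infty,\infty]^d\setminus\mathbb{R}^d)=0$ such that $n\,P(a_n^{-1}X\in\cdot)\to\nu$ vaguely, where $\nu(tA)=t^{-\alpha}\nu(A)$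 for $t>0$ and Borel $A$ bounded away from $0$. *)

(* Defs.v *)
From HB Require Import structures.
From mathcomp Require Import all_boot all_order all_algebra.
From mathcomp Require Import all_classical all_reals all_analysis.

Set Implicit Arguments.
Unset Strict Implicit.
Unset Printing Implicit Defensive.

Import Order.TTheory GRing.Theory Num.Theory.
Import numFieldNormedType.Exports.

Local Open Scope classical_set_scope.
Local Open Scope ring_scope.

(* A random vector in R^d is given by its components X : 'I_d -> {RV P >-> R};
   indices start at 0, so X^(1) is component 0. *)

Section random_vectors.
Context {dT : measure_display} {T : measurableType dT} {R : realType}.
Context {P : probability T R}.

(* Equality is only required on measurable sets because measures are total
   functions on all sets, with arbitrary values off the sigma-algebra. *)
Definition has_law (X : {RV P >-> R}) (F : probability (measurableTypeR R) R) :=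
  forall A : set (measurableTypeR R), measurable A -> distribution P X A = F A.

Definition independent_margins (d : nat) (X : 'I_d -> {RV P >-> R}) :=
  forall (J : {set 'I_d}) (A : 'I_d -> set R), (forall i, measurable (A i)) ->
    P [set w | forall i, i \in J -> A i (X i w)] =
    (\prod_(i in J) P [set w | A i (X i w)])%E.

Definition portfolio_loss (d : nat) (xi : 'I_d -> R) (X : 'I_d -> {RV P >-> R})
  (w : T) : R := \sum_(i < d) xi i * X i w.

End random_vectors.

Definition simplex (R : realType) (d : nat) : set ('I_d -> R) :=
  [set xi | (forall i, 0 <= xi i) /\ \sum_(i < d) xi i = 1].

Definition tail_ratio (R : realType) (a b : \bar R) : \bar R :=
  if b == 0%E then (if a == 0%E then 1%E else +oo%E) else (a / b)%E.

(* X and Y may live on different probability spaces: the order depends only on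
   their laws. *)
Definition apl_le (R : realType) (d : nat)
    (dX dY : measure_display) (TX : measurableType dX) (TY : measurableType dY)
    (PX : probability TX R) (PY : probability TY R)
    (X : 'I_d -> {RV PX >-> R}) (Y : 'I_d -> {RV PY >-> R}) : Prop :=
  forall xi, simplex xi ->
    (limf_esup (fun t : R =>
        tail_ratio (PX [set w | t < portfolio_loss xi X w]%R)
                   (PY [set w | t <= portfolio_loss xi Y w]%R))
      (pinfty_nbhs R) <= 1)%E.

(* The Borel space of [-oo, +oo]^d, for its product topology. *)
Definition ext_space (R : realType) (d : nat) :=
  g_sigma_algebraType (@open 'rV[\bar R]_d).

Section punctured_space.
Context {R : realType} {d : nat}.

Definition ext0 : 'rV[\bar R]_d := const_mx 0%E.

Definition ext_scale (t : R) (x : 'rV[\bar R]_d) : 'rV[\bar R]_d :=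
  map_mx (fun y => t%:E * y)%E x.

Definition ext_real : set 'rV[\bar R]_d :=
  [set x | forall i, x ord0 i \is a fin_num].

(* The Borel measures on [-oo, +oo]^d \ {0} are represented by the Borel
   measures on [-oo, +oo]^d giving no mass to {0}. The compact subsets of the
   punctured space are the compact subsets of [-oo, +oo]^d not containing 0;
   the punctured space being locally compact with a countable base, a Borel
   measure on it is Radon as soon as it is finite on these. *)
Definition punctured_radon
    (nu : {measure set (ext_space R d) -> \bar R}) : Prop :=
  nu [set ext0] = 0%E /\
  forall K : set 'rV[\bar R]_d, compact K -> ~ K ext0 -> (nu K < +oo)%E.

(* C_c of the punctured space, each function being extended by 0 at 0. *)
Definition punctured_Cc (f : 'rV[\bar R]_d -> R) : Prop :=
  continuous f /\
  exists K : set 'rV[\bar R]_d,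
    [/\ compact K, ~ K ext0 & forall x, ~ K x -> f x = 0].

Definition punctured_vague_cvg (mu : nat -> set (ext_space R d) -> \bar R)
    (nu : {measure set (ext_space R d) -> \bar R}) : Prop :=
  forall f, punctured_Cc f ->
    (fun n => \int[mu n]_x (f x)%:E)%E @ \oo --> (\int[nu]_x (f x)%:E)%E.

End punctured_space.

Section regular_variation.
Context {dT : measure_display} {T : measurableType dT} {R : realType}.
Context {P : probability T R} {d : nat}.

Definition rescaled (X : 'I_d -> {RV P >-> R}) (a : R) (w : T) :
  'rV[\bar R]_d := \row_i (a^-1 * X i w)%:E.

Definition mrv (X : 'I_d -> {RV P >-> R}) (alpha : R) : Prop :=
  0 < alpha /\
  exists (a : nat -> R) (nu : {measure set (ext_space R d) -> \bar R}),
    [/\ a @ \oo --> +oo,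
        punctured_radon nu /\ nu setT != 0%E,
        nu (~` ext_real) = 0%E,
        punctured_vague_cvg
          (fun n A => (n%:R%:E * P [set w | A (rescaled X (a n) w)])%E) nu
      & forall (t : R) (A : set (ext_space R d)), 0 < t -> measurable A ->
          ~ closure (A : set 'rV[\bar R]_d) ext0 ->
          nu (ext_scale t @` A) = ((t `^ (- alpha))%:E * nu A)%E].

End regular_variation.

(* Main.v *)
(* Let nu be the limit measure of X, L_xi the loss of a portfolio xi and
   M the l1-norm. Vague convergence, tested on ramps of a suitably capped loss,
   and homogeneity of nu give P(xi'X > t) / P(X_1 > t) -> nu{L_xi > 1} / c,
   where c = nu{x_i > 1} does not depend on i. Slicing space into cones shows
   that nu{L_xi > 1} is the integral of (L_xi / M)^alpha over {M > 1}. Hence,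
   when alpha >= 1, Jensen's inequality gives nu{L_xi > 1} <= c and
   superadditivity of the power gives nu{L_xi > 1} >= c * sum_i xi_i^alpha;
   both are reversed when alpha <= 1. The corresponding limits are 1 for Z and,
   by the one big jump principle, sum_i xi_i^alpha for Y. *)
Require Import Defs.
From HB Require Import structures.
From mathcomp Require Import all_boot all_order all_algebra.
From mathcomp Require Import all_classical all_reals all_analysis measurable_realfun.
From mathcomp Require Import lra.

Set Implicit Arguments.
Unset Strict Implicit.
Unset Printing Implicit Defensive.

Import Order.TTheory GRing.Theory Num.Theory.
Import numFieldNormedType.Exports.

Local Open Scope classical_set_scope.
Local Open Scope ring_scope.

(** * Topology and measurability of the extended space *)

(** An unbounded loss has no continuous real extension to the compact space $[-\infty,\infty]^d$,
    while vague convergence only tests such functions. Capping every coordinate restores continuity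
    and leaves comparisons with levels below 2 intact, up to the null set of infinite points.
    Homogeneity takes the place of a continuity-set argument: the mass of a tail is a power of its
    level times a constant, so ramps around level 1 can be made as tight as wanted. Convergence is
    thereby known along [a n] only; monotonicity of the tails carries it to all real $t$, with $n$
    close to $c / P(X_1 > t)$. No spectral measure is constructed: the integral formula holds up to
    a factor $r^{-\alpha}$ when the slices have ratio $r < 1$, and $r$ then tends to 1. All
    portfolios thus share one integral with the common weight $M^{-\alpha}$, which makes the
    inequalities pointwise. *)

Lemma mx_entry_continuous (T : topologicalType) m n (i : 'I_m) (j : 'I_n) :
  continuous (fun M : 'M[T]_(m, n) => M i j).
Proof.
move=> M A nA; exists (fun k l => if (k == i) && (l == j) then A else setT).
  move=> k l; case: ifPn => [/andP[/eqP -> /eqP ->]//|_].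
  exact: filterT.
by move=> N /(_ i j); rewrite !eqxx.
Qed.

(** Balls of the extended line are pulled back from the real line by [contract], and [contract]
    after [expand] is the clamp to $[-1, 1]$; its continuity is all that has to be checked. *)
Lemma expand_continuous (R : realType) : continuous (@expand R).
Proof.
pose c (u : R) : R := Num.max (-1) (Num.min u 1).
have ce (u : R) : contract (expand u) = c u.
  rewrite /c; have [u1|u1] := leP 1 u.
    by rewrite expand1//= max_r// lerN10.
  have [u2|u2] := leP u (-1).
    by rewrite expandN1.
  by rewrite expandK// inE ler_norml !ltW.
have cc : continuous c.
  move=> u; apply: (@continuous_max R R (cst (-1)) (idfun \min cst 1)).
    exact: cvg_cst.
  by apply: continuous_min; [exact: cvg_id|exact: cvg_cst].
move=> r; apply/cvg_ballP => e e0.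
have /cvg_ballP/(_ e e0) := cc r; apply: filterS => s.
by rewrite /ball/= /ereal_ball !ce.
Qed.

Lemma ereal_compact (R : realType) : compact [set: \bar R].
Proof.
rewrite (_ : setT = (@expand R) @` `[-1, 1]).
  apply: continuous_compact; last exact: segment_compact.
  exact/continuous_subspaceT/expand_continuous.
apply/seteqP; split=> x // _; exists (contract x); last exact: contractK.
by rewrite /= in_itv/= -ler_norml contract_le1.
Qed.

Lemma ext_compact (R : realType) (d : nat) : compact [set: 'rV[\bar R]_d].
Proof.
have := @rV_compact _ d _ (fun=> @ereal_compact R).
by congr compact; apply/seteqP; split.
Qed.

Section ext_space_measurable.
Variables (R : realType) (d : nat).

Lemma ext_open_measurable (A : set 'rV[\bar R]_d) : open A ->
  measurable (A : set (ext_space R d)).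
Proof. by move=> oA; exact: sub_sigma_algebra. Qed.

Lemma ext_continuous_measurable (f : 'rV[\bar R]_d -> R) : continuous f ->
  measurable_fun [set: ext_space R d] f.
Proof.
move=> cf; apply: (measurability _ (RGenOInfty.measurableE R)) => //.
move=> _ [_ [x ->] <-]; rewrite setTI.
apply: ext_open_measurable.
by apply: open_comp; [move=> ? _; exact: cf|exact: interval_open].
Qed.

Lemma ext_entry_measurable (i : 'I_d) :
  measurable_fun [set: ext_space R d]
    ((fun x => x ord0 i) : 'rV[\bar R]_d -> \bar R).
Proof.
apply: (measurability _ (ErealGenOInfty.measurableE R)) => //.
move=> _ [_ [x ->] <-]; rewrite setTI.
apply: ext_open_measurable.
apply: open_comp; first by move=> ? _; exact: mx_entry_continuous.
rewrite (_ : [set` _] = [set y | (x%:E < y)%E]); first exact: open_ereal_gt_ereal.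
by apply/seteqP; split=> y /=; rewrite in_itv/= andbT.
Qed.

Lemma ext_fine_measurable (i : 'I_d) :
  measurable_fun [set: ext_space R d] (fun x : 'rV[\bar R]_d => fine (x ord0 i)).
Proof.
by apply: measurableT_comp; [exact: fine_measurable|exact: ext_entry_measurable].
Qed.

(* An open subset of [R^d] is a countable union of rational cubes. *)
Lemma row_open_measurable (dT : measure_display) (T : measurableType dT)
    (f : 'I_d -> T -> R) (V : set 'rV[R]_d) :
  (forall i, measurable_fun setT (f i)) -> open V ->
  measurable [set w | V (\row_i f i w)].
Proof.
move=> mf oV.
pose B (q : {ffun 'I_d -> rat} * nat) : set 'rV[R]_d :=
  [set v | forall i, `|v ord0 i - ratr (q.1 i)| < q.2.+1%:R^-1].
pose C (q : {ffun 'I_d -> rat} * nat) : set T :=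
  if pselect (B q `<=` V) then [set w | B q (\row_i f i w)] else set0.
rewrite (_ : mkset _ = \bigcup_q C q).
  apply: countable_bigcupT_measurable => [|q]; first exact: countableP.
  rewrite /C; case: pselect => //= _.
  rewrite (_ : mkset _ = \bigcap_(i in [set: 'I_d])
      (f i @^-1` (ball (ratr (q.1 i) : R) q.2.+1%:R^-1))).
    apply: fin_bigcap_measurable => // i _; rewrite -[X in measurable X]setTI.
    by apply: mf => //; exact: measurable_ball.
  apply/seteqP; split=> w /= Bw i; [move=> _|].
    by have := Bw i; rewrite mxE distrC.
  by have := Bw i I; rewrite mxE distrC.
apply/seteqP; split=> w /=; last first.
  by move=> [q _]; rewrite /C; case: pselect => // BV /BV.
move=> Vw; have /nbhs_ballP[e /= e0 eV] : nbhs (\row_i f i w) V.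
  exact: open_nbhs_nbhs.
have [n ne] : exists n : nat, n.+1%:R^-1 < e / 2.
  have e20 : 0 < e / 2 by rewrite divr_gt0.
  have [n _ ne] := near_infty_natSinv_lt (PosNum e20).
  by exists n; apply: (ne n) => /=.
have /choice[q qP] : forall i, exists q : rat, `|f i w - ratr q| < n.+1%:R^-1.
  move=> i; have [|q] := @rat_in_itvoo R (f i w - n.+1%:R^-1) (f i w + n.+1%:R^-1).
    by rewrite ltrBlDr -addrA ltrDl addr_gt0// invr_gt0.
  by rewrite in_itv/= -ltr_distl distrC; exists q.
exists ([ffun i => q i], n) => //.
rewrite /C; case: pselect => [BV|]; first by move=> i; rewrite mxE ffunE.
apply: contra_notP => _ v /= Bv; apply: eV; split=> // k i.
rewrite (ord1 k) mxE /ball/=.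
have := Bv i; rewrite ffunE /= => vq.
rewrite (le_lt_trans (ler_distD (ratr (q i)) _ _))// (splitr e) ltrD//.
  exact: lt_trans (qP i) _.
by rewrite distrC; apply: lt_trans vq _.
Qed.

(** The sigma-algebra is generated by open sets rather than by coordinates. An open set is pulled
    back along the entrywise embedding of $\mathbb{R}^d$, where countable unions of cubes reduce it
    to the components. *)
Lemma rescaled_measurable (dT : measure_display) (T : measurableType dT)
  (P : probability T R) (X : 'I_d -> {RV P >-> R}) (a : R) :
  measurable_fun setT (rescaled X a : T -> ext_space R d).
Proof.
apply: measurability => //.
move=> _ [V oV <-]; rewrite setTI.
have oV' : open ((fun v : 'rV[R]_d => map_mx (@EFin R) v) @^-1` V).
  apply: open_comp => // v _ A [B nB BA].
  exists (fun i j => (@EFin R) @^-1` (B i j)).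
    move=> i j; have := nB i j; rewrite mxE => nBij.
    exact: nBij.
  by move=> u Bu; apply: BA => i j; rewrite mxE; exact: Bu.
have := @row_open_measurable _ _ (fun i w => a^-1 * X i w) _ _ oV'.
rewrite (_ : mkset _ = rescaled X a @^-1` V).
  apply=> i; exact: measurable_funM.
apply/seteqP; split=> w /=; rewrite /rescaled; congr (V _); 
  by apply/matrixP => i j; rewrite !mxE.
Qed.

End ext_space_measurable.

(** * Test functions *)

(** The truncation makes the absolute value a continuous real function on the whole extended line,
    with value [K] at both infinities. *)
Definition cap_abs (R : realType) (K : R) (y : \bar R) : R :=
  fine (mine `|y|%E K%:E).

Section cap_abs.
Variables (R : realType) (K : R).
Hypothesis K0 : 0 <= K.

Lemma cap_abs_fin (r : R) : cap_abs K r%:E = Num.min `|r| K.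
Proof. by rewrite /cap_abs abse_EFin -EFin_min. Qed.

Lemma cap_abs_infty (y : \bar R) : (K%:E <= `|y|)%E -> cap_abs K y = K.
Proof. by move=> Ky; rewrite /cap_abs min_r. Qed.

Lemma cap_abs_ge0 (y : \bar R) : 0 <= cap_abs K y.
Proof. by rewrite /cap_abs fine_ge0// le_min abse_ge0 lee_fin K0. Qed.

Lemma cap_abs_continuous : continuous (@cap_abs R K).
Proof.
have oo y : (K%:E < `|y|)%E -> (\forall z \near y, K%:E <= `|z|)%E ->
    cap_abs K z @[z --> y] --> cap_abs K y.
  move=> Ky nK; rewrite [X in _ --> X]cap_abs_infty ?ltW//.
  apply: cvg_near_cst.
  by apply: filterS nK => z Kz; rewrite cap_abs_infty.
case=> [r| |]; last 2 first.
- apply: oo; first by rewrite ltry.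
  exists K; split; first exact: num_real.
  move=> [z||] //= Kz; rewrite ?leey//= lee_fin (le_trans _ (ler_norm z))//.
  by rewrite ltW -?lte_fin.
- apply: oo; first by rewrite ltry.
  exists (- K); split; first exact: num_real.
  move=> [z||] //= Kz; rewrite ?leey//= lee_fin -normrN (le_trans _ (ler_norm _))//.
  by rewrite lerNr ltW -?lte_fin.
rewrite /continuous_at cap_abs_fin.
apply/cvg_ballP => e e0; apply/nbhs_EFin.
have : Num.min `|s| K @[s --> r] --> Num.min `|r| K.
  apply: (@continuous_min R R (fun s : R => `|s|) (cst K)); last exact: cvg_cst.
  exact: norm_continuous.
move=> /cvg_ballP/(_ e e0); apply: filterS => s.
by rewrite cap_abs_fin.
Qed.

(** Either the cap is reached or it loses nothing; at the infinities [fine] is 0 and the second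
    alternative is trivial. *)
Lemma le_cap_abs (y : \bar R) : K <= `|fine y| \/ cap_abs K y >= `|fine y|.
Proof.
case: y => [r| |] /=.
- rewrite cap_abs_fin; have [rK|Kr] := leP `|r| K; [by right; rewrite lexx|].
  by left; exact: ltW.
- by right; rewrite normr0 cap_abs_ge0.
- by right; rewrite normr0 cap_abs_ge0.
Qed.

Lemma cap_abs_top (y : \bar R) : K <= `|fine y| -> cap_abs K y = K.
Proof.
move=> Ky; apply: cap_abs_infty; case: y Ky => [r| |]//=.
all: by move=> _; rewrite leey.
Qed.

End cap_abs.

Definition ramp (R : realType) (a b u : R) : R :=
  Num.max 0 (Num.min 1 ((b - a)^-1 * (u - a))).

Section ramp.
Variables (R : realType) (a b : R).
Hypothesis ab : a < b.

Lemma ramp_ge0 u : 0 <= ramp a b u.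
Proof. by rewrite /ramp le_max lexx. Qed.

Lemma ramp_le1 u : ramp a b u <= 1.
Proof. by rewrite /ramp ge_max ler01 ge_min lexx. Qed.

Lemma ramp0 u : u <= a -> ramp a b u = 0.
Proof.
move=> ua; apply/eqP; rewrite eq_le ramp_ge0 andbT /ramp ge_max lexx /= ge_min.
by rewrite mulr_ge0_le0 ?orbT ?subr_le0// invr_ge0 subr_ge0 ltW.
Qed.

Lemma ramp1 u : b <= u -> ramp a b u = 1.
Proof.
move=> bu; apply/eqP; rewrite eq_le ramp_le1 /ramp le_max le_min lexx /=.
by rewrite mulrC ler_pdivlMr ?subr_gt0// mul1r lerD2r bu orbT.
Qed.

Lemma ramp_continuous : continuous (ramp a b).
Proof.
pose g u : R := (b - a)^-1 * (u - a).
have cg : continuous g.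
  move=> u; apply: cvgM; first exact: cvg_cst.
  by apply: cvgB; [exact: cvg_id|exact: cvg_cst].
move=> u; apply: (@continuous_max R R (cst 0) (cst 1 \min g)).
  exact: cvg_cst.
by apply: (@continuous_min R R (cst 1) g); [exact: cvg_cst|exact: cg].
Qed.

End ramp.

Section portfolio_functionals.
Variables (R : realType) (d : nat).
Implicit Types (xi : 'I_d -> R) (x : 'rV[\bar R]_d).

(* On nonnegative finite vectors this is the portfolio loss. With absolute
   values there is no need to show that the limit measure charges only the
   positive orthant; [fine] is junk on the null set of infinite vectors. *)
Definition ext_loss xi x : R := \sum_(i < d) xi i * `|fine (x ord0 i)|.

(* Any cap [K] with [2 <= xi i * K] whenever [0 < xi i] would do: capping at
   such a level does not affect the comparison of the loss to levels below 2. *)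
Definition loss_cap xi : R := \sum_(i < d) 2 / xi i.

Definition capped_loss xi x : R :=
  \sum_(i < d) xi i * cap_abs (loss_cap xi) (x ord0 i).

Section properties.
Variable xi : 'I_d -> R.
Hypothesis xi0 : forall i, 0 <= xi i.

Lemma loss_cap_ge0 : 0 <= loss_cap xi.
Proof. by apply: sumr_ge0 => i _; rewrite divr_ge0. Qed.

Lemma capped_loss_continuous : continuous (capped_loss xi).
Proof.
move=> x; have Fx : Filter (nbhs x) := nbhs_filter x.
apply: (@cvg_big _ _ +%R 0 xpredT (@add_continuous R) _ (nbhs x) _ _ _ Fx) => i _.
apply: cvgM; first exact: cvg_cst.
apply: continuous_comp; first exact: mx_entry_continuous.
exact: cap_abs_continuous.
Qed.

Lemma capped_loss0 : capped_loss xi (@ext0 R d) = 0.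
Proof.
rewrite /capped_loss big1// => i _; rewrite mxE cap_abs_fin normr0 min_l ?mulr0//.
exact: loss_cap_ge0.
Qed.

Lemma ext_loss_ge0 x : 0 <= ext_loss xi x.
Proof. by apply: sumr_ge0 => i _; rewrite mulr_ge0. Qed.

Lemma capped_loss_le x : ext_real x -> capped_loss xi x <= ext_loss xi x.
Proof.
move=> xr; apply: ler_sum => i _; rewrite ler_wpM2l//.
move: (xr i) => /fineK <-; rewrite cap_abs_fin ge_min /=.
by rewrite lexx.
Qed.

(** If a coordinate of positive weight reaches the cap, its term alone is at least 2. Otherwise no
    coordinate of positive weight is shortened, and capping does not lower the loss. *)
Lemma ext_loss_lt (s : R) x : s < 2 -> s < ext_loss xi x -> s < capped_loss xi x.
Proof.
move=> s2 sx.
have [[i [xii Ki]]|] := pselect (exists i,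
    0 < xi i /\ loss_cap xi <= `|fine (x ord0 i)|).
  apply: (lt_le_trans s2).
  rewrite /capped_loss (bigD1 i)//= cap_abs_top//.
  apply: ler_wpDr.
    by apply: sumr_ge0 => j _; rewrite mulr_ge0// cap_abs_ge0// loss_cap_ge0.
  (* The cap dominates its own term [2 / xi i]; components of zero weight only add [2 / 0 = 0]. *)
  rewrite -ler_pdivrMl// mulrC /loss_cap (bigD1 i)//= lerDl.
  by apply: sumr_ge0 => j _; rewrite divr_ge0.
move=> nK; apply: (lt_le_trans sx); apply: ler_sum => i _.
have [->|xi_neq0] := eqVneq (xi i) 0; first by rewrite !mul0r.
rewrite ler_wpM2l//.
have [Ki|//] := le_cap_abs loss_cap_ge0 (x ord0 i).
by exfalso; apply: nK; exists i; split => //; rewrite lt_def xi_neq0 xi0.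
Qed.

Lemma capped_loss_ge_compact (a : R) : compact [set x | a <= capped_loss xi x].
Proof.
apply: (@subclosed_compact _ _ setT) => //; last exact: ext_compact.
rewrite (_ : mkset _ = capped_loss xi @^-1` [set y | a <= y])//.
apply: preimage_closed; last exact: closed_ge.
by move=> ? _; exact: capped_loss_continuous.
Qed.

(** As $a > 0$ and the capped loss vanishes at the origin, the ramp is supported in a closed set
    that avoids the origin, and closed sets of the extended space are compact. *)
Lemma ramp_capped_loss_Cc (a b : R) : 0 < a -> a < b ->
  punctured_Cc (ramp a b \o capped_loss xi).
Proof.
move=> a0 ab; split.
  move=> x; apply: continuous_comp; first exact: capped_loss_continuous.
  exact: ramp_continuous.
exists [set x | a <= capped_loss xi x]; split.
- exact: capped_loss_ge_compact.
- by rewrite /= capped_loss0; apply/negP; rewrite -ltNge.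
- by move=> x /= /negP; rewrite -ltNge => /ltW; exact: ramp0.
Qed.

Lemma ext_loss_measurable : measurable_fun [set: ext_space R d] (ext_loss xi).
Proof.
apply: measurable_sum => i; apply: measurable_funM => //.
by apply: measurableT_comp => //; exact: ext_fine_measurable.
Qed.

Lemma capped_loss_measurable :
  measurable_fun [set: ext_space R d] (capped_loss xi).
Proof. by apply: ext_continuous_measurable; exact: capped_loss_continuous. Qed.

Lemma capped_loss_gt_measurable (s : R) :
  measurable ([set x | s < capped_loss xi x] : set (ext_space R d)).
Proof.
rewrite -[X in measurable X]setTI.
rewrite (_ : mkset _ = capped_loss xi @^-1` `]s, +oo[%classic).
  by apply: capped_loss_measurable => //; exact: measurable_itv.
by apply/seteqP; split => x /=; rewrite in_itv/= andbT.
Qed.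

Lemma capped_loss_ge_measurable (s : R) :
  measurable ([set x | s <= capped_loss xi x] : set (ext_space R d)).
Proof.
rewrite -[X in measurable X]setTI.
rewrite (_ : mkset _ = capped_loss xi @^-1` `[s, +oo[%classic).
  by apply: capped_loss_measurable => //; exact: measurable_itv.
by apply/seteqP; split => x /=; rewrite in_itv/= andbT.
Qed.

(** Homogeneity is only available for sets bounded away from the origin. The separating
    neighbourhood comes from the capped loss, which is continuous; the minimum with 1 keeps the
    level below 2. *)
Lemma closure_ext_loss_gt (s : R) : 0 < s ->
  ~ closure [set x | s < ext_loss xi x] (@ext0 R d).
Proof.
move=> s0 cl.
have m0 : 0 < Num.min s 1 by rewrite lt_min s0 ltr01.
have nb : nbhs (@ext0 R d) [set x | capped_loss xi x < Num.min s 1].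
  have cvg0 : capped_loss xi x @[x --> @ext0 R d] --> (0 : R).
    by rewrite -capped_loss0; exact: capped_loss_continuous.
  exact: (cvgr_lt _ cvg0 _ m0).
have [x [/= sx]] := cl _ nb; apply/negP; rewrite -leNgt.
apply/ltW/ext_loss_lt; first by rewrite gt_min ltr1n orbT.
by rewrite gt_min sx.
Qed.

End properties.

End portfolio_functionals.

(** * Homogeneity of the limit measure *)

Lemma powR_continuous (R : realType) (p x : R) : 0 < x ->
  {for x, continuous (fun y : R => y `^ p)}.
Proof.
move=> x0; apply: differentiable_continuous; apply/derivable1_diffP.
by apply: derivable_powR; rewrite in_itv/= x0.
Qed.

(** Together with its left-hand counterpart, this provides constants close to 1. With $p = -\alpha <
    0$ and $g \ge 0$, the side of approach is the one on which $b^p$ moves $g$ towards $y$. *)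
Lemma powR_scaled_gt (R : realType) (p g y : R) : y < g ->
  \forall b \near (1 : R)^'+, y < b `^ p * g.
Proof.
move=> yg; have : b `^ p * g @[b --> (1 : R)^'+] --> 1 `^ p * g.
  apply: cvgM; last exact: cvg_cst.
  by apply: cvg_at_right_filter; exact: powR_continuous.
by rewrite powR1 mul1r => /cvgr_gt; exact.
Qed.

Lemma powR_scaled_lt (R : realType) (p g y : R) : g < y ->
  \forall b \near (1 : R)^'-, b `^ p * g < y.
Proof.
move=> yg; have : b `^ p * g @[b --> (1 : R)^'-] --> 1 `^ p * g.
  apply: cvgM; last exact: cvg_cst.
  by apply: cvg_at_left_filter; exact: powR_continuous.
by rewrite powR1 mul1r => /cvgr_lt; exact.
Qed.

Section homogeneous.
Variables (R : realType) (d : nat) (alpha : R).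
Variable nu : {measure set (ext_space R d) -> \bar R}.
Hypothesis nu_radon : punctured_radon nu.
Hypothesis nu_real : nu (~` @ext_real R d) = 0%E.
Hypothesis nu_homog : forall (t : R) (A : set (ext_space R d)), 0 < t ->
  measurable A -> ~ closure (A : set 'rV[\bar R]_d) (@ext0 R d) ->
  nu (ext_scale t @` A) = ((t `^ (- alpha))%:E * nu A)%E.

Lemma ext_real_measurable : measurable (@ext_real R d : set (ext_space R d)).
Proof.
rewrite (_ : @ext_real R d = \bigcap_(i in [set: 'I_d])
    [set x : 'rV[\bar R]_d | x ord0 i \is a fin_num]).
  apply: fin_bigcap_measurable => // i _.
  have := emeasurable_fin_num measurableT (@ext_entry_measurable R d i).
  by rewrite setTI.
by apply/seteqP; split => [x xr i _|x xr i]; exact: xr.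
Qed.

Definition ext_tail (xi : 'I_d -> R) (s : R) : set (ext_space R d) :=
  [set x | s < ext_loss xi x].

Lemma ext_tail_measurable xi s : measurable (ext_tail xi s).
Proof.
rewrite /ext_tail -[X in measurable X]setTI.
rewrite (_ : mkset _ = ext_loss xi @^-1` `]s, +oo[%classic).
  by apply: ext_loss_measurable => //; exact: measurable_itv.
by apply/seteqP; split => x /=; rewrite in_itv/= andbT.
Qed.

Lemma ext_scaleK (t : R) : t != 0 -> cancel (@ext_scale R d t) (ext_scale t^-1).
Proof.
move=> t0 x; apply/rowP => i; rewrite !mxE muleA -EFinM mulVf// mul1e.
by [].
Qed.

(** Infinite coordinates stay infinite under a positive scaling and count for 0 on both sides. *)
Lemma ext_scale_loss (xi : 'I_d -> R) (t : R) x : 0 < t ->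
  ext_loss xi (ext_scale t x) = t * ext_loss xi x.
Proof.
move=> t0; rewrite /ext_loss mulr_sumr; apply: eq_bigr => i _.
rewrite mxE mulrCA; congr (_ * _).
case: (x ord0 i) => [r| |]; first by rewrite -EFinM/= normrM gtr0_norm.
- by rewrite gt0_muley//= normr0 mulr0.
- by rewrite gt0_muleNy//= normr0 mulr0.
Qed.

Lemma ext_scale_image t (A : set 'rV[\bar R]_d) : 0 < t ->
  ext_scale t @` A = [set x | A (ext_scale t^-1 x)].
Proof.
move=> t0; apply/seteqP; split=> [_ [x Ax <-]|x Ax] /=.
  by rewrite ext_scaleK// gt_eqF.
exists (ext_scale t^-1 x) => //.
by rewrite -[X in ext_scale X]invrK ext_scaleK// invr_neq0// gt_eqF.
Qed.

(** Scaling by [s] maps the cone onto itself and the tail of level 1 onto that of level [s]. The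
    cone is there for the slices of the angular integral. *)
Lemma cone_tail (C : set (ext_space R d)) xi s :
  (forall i, 0 <= xi i) -> measurable C ->
  (forall t x, 0 < t -> C x -> C (ext_scale t x)) -> 0 < s ->
  nu (C `&` ext_tail xi s) = ((s `^ (- alpha))%:E * nu (C `&` ext_tail xi 1))%E.
Proof.
move=> xi0 mC hC s0; rewrite -nu_homog//.
- congr (nu _); rewrite ext_scale_image//; apply/seteqP; split=> x /= [Cx].
    split; first by apply: hC => //; rewrite invr_gt0.
    by rewrite /ext_tail/= ext_scale_loss ?invr_gt0// mulrC ltr_pdivlMr// mul1r.
  rewrite /ext_tail/= ext_scale_loss ?invr_gt0// mulrC ltr_pdivlMr// mul1r.
  split => //; rewrite -[x](@ext_scaleK s^-1) ?invr_neq0 ?gt_eqF// invrK.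
  exact: hC.
- by apply: measurableI => //; exact: ext_tail_measurable.
- move=> cl; apply: (closure_ext_loss_gt xi0 (@ltr01 R)).
  by apply: closureS cl => x [].
Qed.

Lemma nu_tail xi s : (forall i, 0 <= xi i) -> 0 < s ->
  nu (ext_tail xi s) = ((s `^ (- alpha))%:E * nu (ext_tail xi 1))%E.
Proof. by move=> xi0 s0; have := @cone_tail setT xi s; rewrite !setTI; apply. Qed.

(** The sets differ at infinite points only, where the loss counts 0 and the capped loss does not;
    [nu] does not charge them. *)
Lemma nu_capped_tail (xi : 'I_d -> R) (s : R) : (forall i, 0 <= xi i) -> s < 2 ->
  nu [set x | s < capped_loss xi x] = nu (ext_tail xi s).
Proof.
move=> xi0 s2.
have mc := @capped_loss_gt_measurable R d xi s.
have mr := measurableC ext_real_measurable.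
have mt := ext_tail_measurable xi s.
apply/eqP; rewrite eq_le; apply/andP; split; last first.
  apply: le_measure; rewrite ?inE//.
  by move=> x; exact: ext_loss_lt.
rewrite -(measureU0 mt mr nu_real); apply: le_measure; rewrite ?inE//;
  first exact: measurableU.
move=> x /= sx; have [xr|] := pselect (ext_real x); last by right.
by left; apply: (lt_le_trans sx); exact: capped_loss_le.
Qed.

(** Below level 2 the tail has the mass of a subset of a compact set avoiding the origin;
    homogeneity reduces the other levels to level 1. *)
Lemma nu_tail_fin (xi : 'I_d -> R) (s : R) : (forall i, 0 <= xi i) -> 0 < s ->
  nu (ext_tail xi s) \is a fin_num.
Proof.
move=> xi0; wlog s2 : s / s < 2 => [wl s0|s0].
  have [/wl->//|s2] := ltP s 2.
  by rewrite nu_tail// fin_numM//; apply: wl; rewrite ?ltr1n.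
rewrite -nu_capped_tail// ge0_fin_numE//.
have Kc := @capped_loss_ge_compact R d xi s.
have [_ /(_ _ Kc) Kfin] := nu_radon.
apply: le_lt_trans (Kfin _).
  apply: le_measure; rewrite ?inE//.
  - exact: capped_loss_gt_measurable.
  - exact: capped_loss_ge_measurable.
  - by move=> x /ltW.
by rewrite /= capped_loss0//; apply/negP; rewrite -ltNge.
Qed.

End homogeneous.

(** * Vague convergence of the tails *)

(** The measure is arbitrary because the bounds serve both for the rescaled laws and for their
    limit. *)
Lemma integral_ramp_bounds (R : realType) (d : nat)
    (m : {measure set (ext_space R d) -> \bar R}) (xi : 'I_d -> R) (a b : R) :
  a < b ->
  (m [set x | (b < capped_loss xi x)%R] <=
     \int[m]_x (ramp a b (capped_loss xi x))%:E <=
     m [set x | (a < capped_loss xi x)%R])%E.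
Proof.
move=> ab.
have mr : measurable_fun [set: ext_space R d]
    (fun x => (ramp a b (capped_loss xi x))%:E).
  apply/measurable_EFinP; apply: ext_continuous_measurable => x.
  apply: continuous_comp; first exact: capped_loss_continuous.
  exact: ramp_continuous.
have mg s := @capped_loss_gt_measurable R d xi s.
have mi s : measurable_fun [set: ext_space R d]
    (fun x => (\1_[set x | (s < capped_loss xi x)%R] x : R)%:E).
  by apply/measurable_EFinP; exact: measurable_indic.
apply/andP; split.
  rewrite -[X in (m X <= _)%E]setIT -integral_indic//.
  apply: ge0_le_integral => //.
  move=> x _; rewrite lee_fin indicE; have [|_] := boolP (x \in _).
    by rewrite inE /= => /ltW bx; rewrite ramp1.
  exact: ramp_ge0.
rewrite -[X in (_ <= m X)%E]setIT -integral_indic//.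
apply: ge0_le_integral => //.
  by move=> x _; rewrite lee_fin ramp_ge0.
move=> x _; rewrite lee_fin indicE; have [_|] := boolP (x \in _).
  exact: ramp_le1.
by rewrite notin_setE /= => /negP; rewrite -leNgt => xa; rewrite ramp0.
Qed.

Section rescaled_law.
Context {dT : measure_display} {T : measurableType dT} {R : realType}.
Context {P : probability T R} {d : nat}.
Variable X : 'I_d -> {RV P >-> R}.

(** Fixing the target type lets the map carry the measurable-function structure that [distribution]
    expects. *)
Definition rescaled_ext (a : R) : T -> ext_space R d := rescaled X a.

HB.instance Definition _ a := @isMeasurableFun.Build _ _ _ _
  (rescaled_ext a) (@rescaled_measurable R d _ T P X a).

(** This packages the set function of [mrv] as a measure, to which the lemmas on integrals apply. *)
Definition rescaled_measure (a : R) (n : nat) :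
    {measure set (ext_space R d) -> \bar R} :=
  mscale (NngNum (ler0n R n)) (distribution P (rescaled_ext a)).

Definition loss_tail (xi : 'I_d -> R) (t : R) : R :=
  fine (P [set w | t < portfolio_loss xi X w]).

Lemma portfolio_loss_measurable xi :
  measurable_fun setT (portfolio_loss xi X).
Proof. by apply: measurable_sum => i; exact: measurable_funM. Qed.

Lemma loss_gt_measurable xi t :
  measurable [set w | t < portfolio_loss xi X w].
Proof.
rewrite -[X in measurable X]setTI.
rewrite (_ : mkset _ = portfolio_loss xi X @^-1` `]t, +oo[%classic).
  by apply: portfolio_loss_measurable => //; exact: measurable_itv.
by apply/seteqP; split => x /=; rewrite in_itv/= andbT.
Qed.

Lemma loss_tailE xi t :
  (loss_tail xi t)%:E = P [set w | t < portfolio_loss xi X w].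
Proof. by rewrite fineK// fin_num_measure//; exact: loss_gt_measurable. Qed.

Lemma loss_tail_ge0 xi t : 0 <= loss_tail xi t.
Proof. by rewrite fine_ge0. Qed.

Lemma loss_tail_nincr xi s t : s <= t -> loss_tail xi t <= loss_tail xi s.
Proof.
move=> st; rewrite -lee_fin !loss_tailE; apply: le_measure; rewrite ?inE//.
- exact: loss_gt_measurable.
- exact: loss_gt_measurable.
- by move=> w /=; exact: le_lt_trans.
Qed.

Hypothesis X_ge0 : forall w i, 0 <= X i w.

Lemma rescaled_loss xi (a : R) w : 0 < a ->
  ext_loss xi (rescaled X a w) = a^-1 * portfolio_loss xi X w.
Proof.
move=> a0; rewrite /ext_loss /portfolio_loss mulr_sumr; apply: eq_bigr => i _.
by rewrite mxE/= ger0_norm; [rewrite mulrCA|rewrite mulr_ge0// invr_ge0 ltW].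
Qed.

Lemma rescaled_real (a : R) w : ext_real (rescaled X a w).
Proof. by move=> i; rewrite mxE. Qed.

Lemma rescaled_measure_tail xi (a s : R) n : (forall i, 0 <= xi i) ->
  0 < a -> s < 2 ->
  rescaled_measure a n [set x | s < capped_loss xi x] =
  (n%:R * loss_tail xi (s * a))%:E.
Proof.
move=> xi0 a0 s2; rewrite EFinM loss_tailE; congr (_ * P _)%E.
apply/seteqP; split=> w /= sw.
  rewrite -ltr_pdivlMr// mulrC -rescaled_loss//; apply: (lt_le_trans sw).
  exact/capped_loss_le/rescaled_real.
by apply: ext_loss_lt => //; rewrite rescaled_loss// mulrC ltr_pdivlMr.
Qed.

Variables (alpha : R) (a : nat -> R).
Variable nu : {measure set (ext_space R d) -> \bar R}.
Hypothesis a_cvg : a @ \oo --> +oo.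
Hypothesis nu_radon : punctured_radon nu.
Hypothesis nu_real : nu (~` @ext_real R d) = 0%E.
Hypothesis nu_homog : forall (t : R) (A : set (ext_space R d)), 0 < t ->
  measurable A -> ~ closure (A : set 'rV[\bar R]_d) (@ext0 R d) ->
  nu (ext_scale t @` A) = ((t `^ (- alpha))%:E * nu A)%E.
Hypothesis nu_lim : punctured_vague_cvg
  (fun n A => (n%:R%:E * P [set w | A (rescaled X (a n) w)])%E) nu.

Definition limit_tail (xi : 'I_d -> R) : R := fine (nu (ext_tail xi 1)).

Lemma limit_tailE xi s : (forall i, 0 <= xi i) -> 0 < s ->
  nu (ext_tail xi s) = (s `^ (- alpha) * limit_tail xi)%:E.
Proof.
move=> xi0 s0; rewrite (nu_tail nu_homog)// EFinM fineK//.
exact: (nu_tail_fin nu_radon nu_real nu_homog).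
Qed.

Lemma limit_tail_ge0 xi : 0 <= limit_tail xi.
Proof. by rewrite fine_ge0. Qed.

Lemma vague_ramp xi (u v : R) : (forall i, 0 <= xi i) -> 0 < u -> u < v ->
  (fun n => (\int[rescaled_measure (a n) n]_x (ramp u v (capped_loss xi x))%:E)%E)
    @ \oo --> (\int[nu]_x (ramp u v (capped_loss xi x))%:E)%E.
Proof. by move=> xi0 u0 uv; apply: nu_lim; exact: ramp_capped_loss_Cc. Qed.

(** The ramp from 1 to [b] bounds the tail at [a n] from below, and its limit integral is at least
    the mass of the tail of level [b], that is $b^{-\alpha}$ times [limit_tail xi]. The upper bound
    uses the ramp from some [b < 1] to 1 in the same way. *)
Lemma tail_lim_gt xi y : (forall i, 0 <= xi i) -> y < limit_tail xi ->
  \forall n \near \oo, y < n%:R * loss_tail xi (a n).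
Proof.
move=> xi0 yg.
have [b [b1 b2 yb]] : exists b : R,
    [/\ 1 < b, b < 2 & y < b `^ (- alpha) * limit_tail xi].
  near (1 : R)^'+ => b; exists b; split.
  - by near: b; exact: nbhs_right_gt.
  - by near: b; apply: nbhs_right_lt; rewrite ltr1n.
  - by near: b; exact: powR_scaled_gt.
have /andP[+ _] := @integral_ramp_bounds R d nu xi _ _ b1.
rewrite nu_capped_tail// limit_tailE// ?(lt_trans ltr01)// => nub.
have yI : (y%:E < \int[nu]_x (ramp 1 b (capped_loss xi x))%:E)%E.
  by apply: lt_le_trans nub; rewrite lte_fin.
have nI := vague_ramp xi0 ltr01 b1 (open_ereal_gt' yI).
near=> n.
have an0 : 0 < a n by near: n; apply: cvgry_gt.
have /andP[_] := @integral_ramp_bounds R d (rescaled_measure (a n) n) xi _ _ b1.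
rewrite rescaled_measure_tail// ?ltr1n// mul1r -lte_fin; apply: lt_le_trans.
by near: n; exact: nI.
Unshelve. all: end_near. Qed.

Lemma tail_lim_lt xi y : (forall i, 0 <= xi i) -> limit_tail xi < y ->
  \forall n \near \oo, n%:R * loss_tail xi (a n) < y.
Proof.
move=> xi0 yg.
have [b [b0 b1 yb]] : exists b : R,
    [/\ 0 < b, b < 1 & b `^ (- alpha) * limit_tail xi < y].
  near (1 : R)^'- => b; exists b; split.
  - by near: b; exact: nbhs_left_gt.
  - by near: b; exact: nbhs_left_lt.
  - by near: b; exact: powR_scaled_lt.
have /andP[_] := @integral_ramp_bounds R d nu xi _ _ b1.
rewrite nu_capped_tail// ?(lt_trans b1) ?ltr1n// limit_tailE// => nub.
have yI : (\int[nu]_x (ramp b 1 (capped_loss xi x))%:E < y%:E)%E.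
  by apply: le_lt_trans nub _; rewrite lte_fin.
have nI := vague_ramp xi0 b0 b1 (open_ereal_lt' yI).
near=> n.
have an0 : 0 < a n by near: n; apply: cvgry_gt.
have /andP[+ _] := @integral_ramp_bounds R d (rescaled_measure (a n) n) xi _ _ b1.
rewrite rescaled_measure_tail// ?ltr1n// mul1r -lte_fin; move/le_lt_trans; apply.
by near: n; exact: nI.
Unshelve. all: end_near. Qed.

Lemma tail_cvg xi : (forall i, 0 <= xi i) ->
  n%:R * loss_tail xi (a n) @[n --> \oo] --> limit_tail xi.
Proof.
move=> xi0; apply/cvgrPdist_lt => e e0.
near=> n; rewrite distrC ltr_distl; apply/andP; split.
  by near: n; apply: tail_lim_gt; rewrite // gtrBl.
by near: n; apply: tail_lim_lt; rewrite // ltrDl.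
Unshelve. all: end_near. Qed.

End rescaled_law.

(** * Ratios of regularly varying tails *)

(** Truncating $c / F(t)$ gives $n F(t) \le c < (n+1) F(t)$, so limits are needed with both factors;
    $u_n$ tends to 0 because $n u_n$ converges. *)
Lemma cvg_succ_mul (R : realType) (u : nat -> R) (l : R) :
  n%:R * u n @[n --> \oo] --> l -> n.+1%:R * u n @[n --> \oo] --> l.
Proof.
move=> ul; have u0 : u n @[n --> \oo] --> (0 : R).
  rewrite -[X in _ --> X](mulr0 l).
  apply: (@cvg_trans _ ((n%:R * u n * n%:R^-1) @[n --> \oo])).
    apply: near_eq_cvg; near=> n; rewrite mulrAC divff ?mul1r// pnatr_eq0 -lt0n.
    by near: n; exact: nbhs_infty_gt.
  apply: cvgM => //; apply/gtr0_cvgV0; last exact: cvgr_idn.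
  by near=> n; rewrite ltr0n; near: n; exact: nbhs_infty_gt.
rewrite -[X in _ --> X]addr0.
rewrite (_ : (fun n => _) = (fun n => n%:R * u n + u n)); first exact: cvgD.
by apply/funext => n; rewrite -natr1 mulrDl mul1r.
Unshelve. all: end_near. Qed.

Lemma powRN_gt1 (R : realType) (p s : R) : 0 < p -> 0 < s -> s < 1 ->
  1 < s `^ (- p).
Proof.
move=> p0 s0 s1; rewrite powRN invf_gt1 ?powR_gt0//.
by have := gt0_ltr_powR p0 _ _ s1; rewrite powR1; apply; rewrite nnegrE// ltW.
Qed.

Lemma powRN_lt1 (R : realType) (p s : R) : 0 < p -> 1 < s -> s `^ (- p) < 1.
Proof.
move=> p0 s1; rewrite powRN invf_lt1 ?powR_gt0 ?(lt_trans ltr01)//.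
have := gt0_ltr_powR p0 _ _ s1; rewrite powR1; apply; rewrite nnegrE//.
by rewrite ltW// (lt_trans ltr01).
Qed.

Section tail_ratio.
Variables (R : realType) (alpha c g : R) (a : nat -> R) (F G : R -> R).
Hypothesis alpha0 : 0 < alpha.
Hypothesis c0 : 0 < c.
Hypothesis a_cvg : a @ \oo --> +oo.
Hypothesis F_nincr : forall s t, s <= t -> F t <= F s.
Hypothesis G_nincr : forall s t, s <= t -> G t <= G s.
Hypothesis G_ge0 : forall t, 0 <= G t.
Hypothesis F_lim : forall s, 0 < s ->
  n%:R * F (s * a n) @[n --> \oo] --> s `^ (- alpha) * c.
Hypothesis G_lim : forall s, 0 < s ->
  n%:R * G (s * a n) @[n --> \oo] --> s `^ (- alpha) * g.

(** For large $n$, $F(a_n)$ is positive since $n F(a_n)$ tends to $c > 0$, and $a_n$ is beyond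
    $t$. *)
Lemma tail_gt0 t : 0 < F t.
Proof.
near \oo => n.
have : 0 < n%:R * F (1 * a n).
  near: n; apply: (cvgr_gt _ (F_lim ltr01)).
  by rewrite powR1 mul1r.
have n0 : 0 < n%:R :> R.
  by rewrite ltr0n; near: n; exact: nbhs_infty_gt.
rewrite mul1r pmulr_rgt0// => Fn; apply: (lt_le_trans Fn); apply: F_nincr.
by near: n; apply: cvgry_ge.
Unshelve. all: end_near. Qed.

Lemma tail_cvg0 e : 0 < e -> \forall t \near +oo, F t < e.
Proof.
move=> e0; near \oo => n.
have n0 : 0 < n%:R :> R.
  by rewrite ltr0n; near: n; exact: nbhs_infty_gt.
have Fn : n%:R * F (1 * a n) < c + 1.
  near: n; apply: (cvgr_lt _ (F_lim ltr01)).
  by rewrite powR1 mul1r ltrDl.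
have ne : (c + 1) / e < n%:R by near: n; apply: (cvgry_gt cvgr_idn).
exists (a n); split; first exact: num_real.
move=> t /ltW/F_nincr Ft; apply: (le_lt_trans Ft).
rewrite -(ltr_pM2l n0) -[a n]mul1r; apply: (lt_trans Fn).
by rewrite -ltr_pdivrMr.
Unshelve. all: end_near. Qed.

(* For [n = floor (c / F t)] one has [n F(t) <= c < (n + 1) F(t)]; as
   [n F(s a_n)] tends to [s^(-alpha) c], this pins [t] between [s a_n] and
   [s' a_n] for any [s < 1 < s']. *)
Lemma near_truncn_tail (Q : set nat) : (\forall n \near \oo, Q n) ->
  \forall t \near +oo, Q (Num.truncn (c / F t)).
Proof.
move=> [N _ NQ]; have [N0|N0] := posnP N.
  by near=> t; apply: NQ; rewrite /= N0.
near=> t; apply: NQ => /=.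
rewrite truncn_ge_nat; last by rewrite divr_ge0 ?ltW ?tail_gt0.
rewrite ler_pdivlMr ?tail_gt0// mulrC -ler_pdivlMr ?ltr0n// ltW//.
by near: t; apply: tail_cvg0; rewrite divr_gt0 ?ltr0n.
Unshelve. all: end_near. Qed.

Lemma truncn_tail_le t : (Num.truncn (c / F t))%:R * F t <= c.
Proof.
by rewrite -ler_pdivlMr ?tail_gt0// truncn_le// divr_ge0 ?ltW ?tail_gt0.
Qed.

Lemma truncn_tail_gt t : c < (Num.truncn (c / F t)).+1%:R * F t.
Proof. by rewrite -ltr_pdivrMr ?tail_gt0// truncnS_gt. Qed.

(** For $s < 1$ close to 1, $n F(s a_n) > c \ge n F(t)$ forces $s a_n \le t$. Hence $(n+1) G(t) \le
    (n+1) G(s a_n) < y c < y (n+1) F(t)$. *)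
Lemma tail_ratio_lt y : g / c < y -> \forall t \near +oo, G t / F t < y.
Proof.
rewrite ltr_pdivrMr// => yg.
have [s [s0 s1 sg sc]] : exists s : R,
    [/\ 0 < s, s < 1, s `^ (- alpha) * g < y * c & c < s `^ (- alpha) * c].
  near (1 : R)^'- => b; exists b; split.
  - by near: b; exact: nbhs_left_gt.
  - by near: b; exact: nbhs_left_lt.
  - by near: b; exact: powR_scaled_lt.
  - by rewrite ltr_pMl// powRN_gt1.
have nG : \forall n \near \oo, n.+1%:R * G (s * a n) < y * c.
  exact: (cvgr_lt _ (cvg_succ_mul (G_lim s0))).
have nF : \forall n \near \oo, c < n%:R * F (s * a n).
  exact: (cvgr_gt _ (F_lim s0)).
apply: filterS2 (near_truncn_tail nG) (near_truncn_tail nF) => t nGt nFt.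
rewrite ltr_pdivrMr ?tail_gt0//; set n := Num.truncn (c / F t) in nGt nFt *.
have st : s * a n <= t.
  rewrite leNgt; apply/negP => /ltW/F_nincr Ft.
  have := lt_le_trans nFt (ler_wpM2l (ler0n R n) Ft).
  by apply/negP; rewrite -leNgt truncn_tail_le.
rewrite -(@ltr_pM2l _ n.+1%:R)//.
have y0 : 0 < y.
  by rewrite -(pmulr_lgt0 _ c0); apply: le_lt_trans nGt; rewrite mulr_ge0.
apply: le_lt_trans (ler_wpM2l (ler0n R n.+1) (G_nincr st)) _.
apply: (lt_trans nGt); rewrite mulrCA ltr_pM2l//.
exact: truncn_tail_gt.
Unshelve. all: end_near. Qed.

(** Now $s > 1$ and the factors are exchanged: $(n+1) F(s a_n) < c < (n+1) F(t)$ forces $t \le s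
    a_n$, and $n G(t) \ge n G(s a_n) > y c \ge y n F(t)$. *)
Lemma tail_ratio_gt y : y < g / c -> \forall t \near +oo, y < G t / F t.
Proof.
rewrite ltr_pdivlMr// => yg.
have [s [s1 sg sc]] : exists s : R,
    [/\ 1 < s, y * c < s `^ (- alpha) * g & s `^ (- alpha) * c < c].
  near (1 : R)^'+ => b; exists b; split.
  - by near: b; exact: nbhs_right_gt.
  - by near: b; exact: powR_scaled_gt.
  - by rewrite gtr_pMl// powRN_lt1.
have s0 := lt_trans ltr01 s1.
have nG : \forall n \near \oo, y * c < n%:R * G (s * a n).
  exact: (cvgr_gt _ (G_lim s0)).
have nF : \forall n \near \oo, n.+1%:R * F (s * a n) < c.
  exact: (cvgr_lt _ (cvg_succ_mul (F_lim s0))).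
have nn := near_truncn_tail (nbhs_infty_gt 0).
apply: filterS3 (near_truncn_tail nG) (near_truncn_tail nF) nn => t nGt nFt n0.
rewrite ltr_pdivlMr ?tail_gt0//; set n := Num.truncn (c / F t) in nGt nFt n0 *.
have {}n0 : 0 < n%:R :> R by rewrite ltr0n.
(* Negative [y] is set apart because the final chain multiplies $n F(t) \le c$ by [y]. *)
have [y0|y0] := ltP y 0.
  by apply: (@lt_le_trans _ _ 0) => //; rewrite nmulr_rlt0// tail_gt0.
have st : t <= s * a n.
  rewrite leNgt; apply/negP => /ltW/F_nincr Ft.
  have := le_lt_trans (ler_wpM2l (ler0n R n.+1) Ft) nFt.
  by apply/negP; rewrite -leNgt ltW// truncn_tail_gt.
rewrite -(ltr_pM2l n0).
apply: lt_le_trans (ler_wpM2l (ltW n0) (G_nincr st)).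
apply: le_lt_trans nGt; rewrite mulrCA ler_wpM2l//.
exact: truncn_tail_le.
Unshelve. all: end_near. Qed.

Lemma tail_ratio_cvg : G t / F t @[t --> +oo] --> g / c.
Proof.
apply/cvgrPdist_lt => e e0.
near=> t; rewrite distrC ltr_distl; apply/andP; split.
  by near: t; apply: tail_ratio_gt; rewrite gtrBl.
by near: t; apply: tail_ratio_lt; rewrite ltrDl.
Unshelve. all: end_near. Qed.

End tail_ratio.

(** * The angular integral *)

Lemma geometric_bracket (R : realType) (r u : R) : 0 < r -> r < 1 ->
  0 < u -> u <= 1 -> exists k : nat, r ^+ k.+1 < u <= r ^+ k.
Proof.
move=> r0 r1 u0 u1.
have exn : exists n, r ^+ n < u.
  near \oo => n; exists n; near: n.
  have : r ^+ n @[n --> \oo] --> (0 : R) by apply: cvg_expr; rewrite gtr0_norm.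
  by move=> /cvgr_lt; exact.
case: (ex_minnP exn) => -[|k]; first by rewrite expr0 ltNge u1.
move=> ku kmin; exists k; rewrite ku /= leNgt; apply/negP => /kmin.
by rewrite ltnn.
Unshelve. all: end_near. Qed.

Lemma powRNK (R : realType) (p x : R) : 0 < x -> x `^ p * x `^ (- p) = 1.
Proof. by move=> x0; rewrite powRN mulfV// gt_eqF// powR_gt0. Qed.

Section spectral.
Variables (R : realType) (d : nat) (alpha : R).
Variable nu : {measure set (ext_space R d) -> \bar R}.
Hypothesis alpha0 : 0 < alpha.
Hypothesis nu_radon : punctured_radon nu.
Hypothesis nu_real : nu (~` @ext_real R d) = 0%E.
Hypothesis nu_homog : forall (t : R) (A : set (ext_space R d)), 0 < t ->
  measurable A -> ~ closure (A : set 'rV[\bar R]_d) (@ext0 R d) ->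
  nu (ext_scale t @` A) = ((t `^ (- alpha))%:E * nu A)%E.

Let M : 'rV[\bar R]_d -> R := ext_loss (fun=> 1).
Let D : set (ext_space R d) := ext_tail (fun=> 1) 1.

Let mD : measurable D. Proof. exact: ext_tail_measurable. Qed.
Let M_ge0 x : 0 <= M x. Proof. exact: ext_loss_ge0. Qed.

(* The integrand is the [alpha]-th power of the loss of the point of the
   l1-sphere on the ray through [x]. *)
Definition angular_loss (xi : 'I_d -> R) (x : 'rV[\bar R]_d) : R :=
  ext_loss xi x `^ alpha * M x `^ (- alpha).

Definition angular_integral (xi : 'I_d -> R) : \bar R :=
  (\int[nu]_(x in D) (angular_loss xi x)%:E)%E.

Lemma angular_loss_ge0 xi x : 0 <= angular_loss xi x.
Proof. by rewrite mulr_ge0// powR_ge0. Qed.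

Lemma angular_loss_measurable (B : set (ext_space R d)) xi :
  measurable_fun B (fun x => (angular_loss xi x)%:E).
Proof.
apply/measurable_EFinP; apply: (@measurable_funS _ _ _ _ setT) => //.
by apply: measurable_funM; apply: (measurableT_comp (measurable_powR _));
  exact: ext_loss_measurable.
Qed.

(* On the cone [slice k] the ratio of the loss to the l1-norm is [r ^+ k] up to
   a factor [r]; there both [nu {loss > 1}] and the angular integral agree, up
   to a factor [r `^ alpha], with [(r ^+ k) `^ alpha * nu (slice k `&` D)]. *)
Section cone_slices.
Variables (xi : 'I_d -> R) (r : R).
Hypothesis xi_ge0 : forall i, 0 <= xi i.
Hypothesis xi_le1 : forall i, xi i <= 1.
Hypothesis r0 : 0 < r.
Hypothesis r1 : r < 1.

Let slice (k : nat) : set (ext_space R d) :=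
  [set x | r ^+ k.+1 * M x < ext_loss xi x <= r ^+ k * M x].

(** The ratio of loss to norm stays in $[0, 1]$, so slices of nonnegative index suffice. *)
Let loss_le x : ext_loss xi x <= M x.
Proof. by apply: ler_sum => i _; rewrite ler_wpM2r. Qed.

Let slice_measurable k : measurable (slice k).
Proof.
rewrite (_ : slice k =
  [set x | r ^+ k.+1 * M x < ext_loss xi x] `&`
  [set x | ext_loss xi x <= r ^+ k * M x]); last first.
  by apply/seteqP; split=> x /= /andP.
have mM c : measurable_fun [set: ext_space R d] (fun x => c * M x).
  by apply: measurable_funM => //; exact: ext_loss_measurable.
have mX := @ext_loss_measurable R d xi.
apply: measurableI.
  rewrite -[X in measurable X]setTI.
  exact: (measurable_fun_ltr (mM _) mX measurableT (Y := [set true])).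
rewrite -[X in measurable X]setTI.
exact: (measurable_fun_ler mX (mM _) measurableT (Y := [set true])).
Qed.

Let slice_scale k t x : 0 < t -> slice k x -> slice k (ext_scale t x).
Proof.
move=> t0; rewrite /slice/= /M !ext_scale_loss//.
by rewrite ![_ * (t * _)]mulrCA ltr_pM2l// ler_pM2l.
Qed.

Let slice_triv : trivIset [set: nat] slice.
Proof.
apply: ltn_trivIset => k j jk; apply/seteqP; split=> // x [/andP[xj _] /andP[_ kx]].
have := lt_le_trans xj kx; rewrite ltNge; apply/negP.
by rewrite negbK ler_wpM2r// ler_wiXn2l// ltW.
Qed.

(** The slices miss exactly the points of zero loss. These lie outside the tail of [xi], and the
    angular integrand vanishes there since $0^\alpha = 0$. *)
Let bigcup_slice (E : set (ext_space R d)) :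
  \bigcup_k (slice k `&` E) = E `&` [set x | 0 < ext_loss xi x].
Proof.
apply/seteqP; split=> x /=.
  move=> [k _ [/andP[xk _] Ex]]; split => //; apply: le_lt_trans xk.
  by rewrite mulr_ge0// exprn_ge0// ltW.
move=> [Ex x0].
have M0 : 0 < M x by exact: lt_le_trans (loss_le x).
have [||k] := @geometric_bracket R r (ext_loss xi x / M x) r0 r1.
- by rewrite divr_gt0.
- by rewrite ler_pdivrMr// mul1r.
- by rewrite ltr_pdivlMr// ler_pdivrMr// => xk; exists k.
Qed.

Let nu_slices : nu (ext_tail xi 1) =
  (\sum_(0 <= k <oo) nu (slice k `&` ext_tail xi 1))%E.
Proof.
have mS k : measurable (slice k `&` ext_tail xi 1).
  by apply: measurableI => //; exact: ext_tail_measurable.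
rewrite -measure_semi_bigcup//.
- rewrite bigcup_slice; congr (nu _); apply/seteqP; split=> x; last by case.
  by move=> /= x1; split => //; exact: lt_trans x1.
- exact: trivIset_setIr.
- by apply: bigcup_measurable => k _; exact: mS.
Qed.

Let angular_slices : angular_integral xi =
  (\sum_(0 <= k <oo) \int[nu]_(x in slice k `&` D) (angular_loss xi x)%:E)%E.
Proof.
have mS k : measurable (slice k `&` D) by exact: measurableI.
rewrite -ge0_integral_bigcup//; last 3 first.
- exact: angular_loss_measurable.
- by move=> x _; rewrite lee_fin angular_loss_ge0.
- exact: trivIset_setIr.
rewrite bigcup_slice /angular_integral.
rewrite -[in LHS](setUIDK D (ext_tail xi 0)) ge0_integral_setU//.
- rewrite [X in (_ + X)%E]integral0_eq ?adde0// => x [_ /negP].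
  rewrite -leNgt => x0; rewrite /angular_loss.
  have -> : ext_loss xi x = 0 by apply/eqP; rewrite eq_le x0 ext_loss_ge0.
  by rewrite powR0 ?mul0r// gt_eqF.
- by apply: measurableI => //; exact: ext_tail_measurable.
- by apply: measurableD => //; exact: ext_tail_measurable.
- exact: angular_loss_measurable.
- by move=> x _; rewrite lee_fin angular_loss_ge0.
- by apply/disj_set2P; rewrite setDE setIACA setICr setI0.
Qed.

Let slice_integral_bounds k :
  (((r ^+ k.+1) `^ alpha)%:E * nu (slice k `&` D) <=
    \int[nu]_(x in slice k `&` D) (angular_loss xi x)%:E <=
   ((r ^+ k) `^ alpha)%:E * nu (slice k `&` D))%E.
Proof.
have mS : measurable (slice k `&` D) by exact: measurableI.
have bd x : (slice k `&` D) x ->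
    (r ^+ k.+1) `^ alpha <= angular_loss xi x <= (r ^+ k) `^ alpha.
  move=> [/andP[xk kx] Dx]; have M0 : 0 < M x by apply: lt_trans Dx.
  (* The constant bounds are given the shape of the integrand, so that monotonicity of the power
     applies. *)
  have p j : (r ^+ j) `^ alpha = (r ^+ j * M x) `^ alpha * M x `^ (- alpha).
    by rewrite powRM ?exprn_ge0 ?ltW// -mulrA powRNK// mulr1.
  have pw j : 0 <= r ^+ j * M x by rewrite mulr_ge0 ?exprn_ge0// ltW.
  have g0 : 0 <= ext_loss xi x by exact: ext_loss_ge0.
  rewrite /angular_loss !p; apply/andP; split; apply: ler_wpM2r;
    rewrite ?powR_ge0//; apply: ge0_ler_powR; rewrite ?nnegrE// ltW//.
rewrite -!integral_cst//; apply/andP; split; apply: ge0_le_integral => //.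
- by move=> x _; rewrite lee_fin powR_ge0.
- exact: angular_loss_measurable.
- by move=> x /bd/andP[+ _]; rewrite lee_fin.
- by move=> x _; rewrite lee_fin angular_loss_ge0.
- exact: angular_loss_measurable.
- by move=> x /bd/andP[_]; rewrite lee_fin.
Qed.

(** By homogeneity on the cone, $(r^j)^\alpha$ times the mass of the slice in $\{M > 1\}$ is its
    mass in $\{M > r^{-j}\}$. On slice $k$, $M > r^{-(k+1)}$ forces a loss above 1, which in turn
    forces $M > r^{-k}$. *)
Let slice_tail_bounds k :
  (((r ^+ k.+1) `^ alpha)%:E * nu (slice k `&` D) <=
    nu (slice k `&` ext_tail xi 1) <=
   ((r ^+ k) `^ alpha)%:E * nu (slice k `&` D))%E.
Proof.
have rp j : (((r ^+ j) `^ alpha)%:E * nu (slice k `&` D))%E =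
    nu (slice k `&` ext_tail (fun=> 1) (r ^+ j)^-1).
  rewrite (cone_tail nu_homog)//; last 2 first.
  - by move=> t x; exact: slice_scale.
  - by rewrite invr_gt0 exprn_gt0.
  by rewrite -(powR_inv1 (exprn_ge0 j (ltW r0))) -powRrM mulN1r opprK.
have mT zeta s : measurable (slice k `&` ext_tail zeta s).
  by apply: measurableI => //; exact: ext_tail_measurable.
rewrite !rp; apply/andP; split; apply: le_measure; rewrite ?inE//.
  move=> x [] /[dup] sx /andP[xk kx]; rewrite /ext_tail/= => xM; split => //.
  apply: le_lt_trans xk.
  by rewrite mulrC -ler_pdivrMr ?exprn_gt0// mul1r ltW.
move=> x [] /[dup] sx /andP[xk kx]; rewrite /ext_tail/= => xM; split => //.
by rewrite -[ltLHS]mul1r ltr_pdivrMr ?exprn_gt0// mulrC; apply: lt_le_trans kx.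
Qed.

(** On each slice the upper bound of one quantity is $r^{-\alpha}$ times the lower bound of the
    other; the factor survives summation over the slices. *)
Lemma tail_le_angular :
  (nu (ext_tail xi 1) <= (r `^ (- alpha))%:E * angular_integral xi)%E.
Proof.
rewrite nu_slices angular_slices -nneseriesZl; last first.
  by move=> k _; apply: integral_ge0 => x _; rewrite lee_fin angular_loss_ge0.
apply: lee_nneseries => // k _.
have /andP[_ /le_trans] := slice_tail_bounds k; apply.
have /andP[/(lee_wpmul2l _) + _] := slice_integral_bounds k.
move=> /(_ (r `^ (- alpha))%:E); rewrite lee_fin powR_ge0 => /(_ isT).
apply: le_trans.
rewrite muleA -EFinM exprS powRM ?exprn_ge0 ?(ltW r0)// mulrA.
by rewrite [_ * r `^ _]mulrC powRNK// mul1r.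
Qed.

Lemma angular_le_tail :
  (angular_integral xi <= (r `^ (- alpha))%:E * nu (ext_tail xi 1))%E.
Proof.
rewrite nu_slices angular_slices -nneseriesZl//.
apply: lee_nneseries => [k _ _|k _].
  by apply: integral_ge0 => x _; rewrite lee_fin angular_loss_ge0.
have /andP[_ /le_trans] := slice_integral_bounds k; apply.
have /andP[/(lee_wpmul2l _) + _] := slice_tail_bounds k.
move=> /(_ (r `^ (- alpha))%:E); rewrite lee_fin powR_ge0 => /(_ isT).
apply: le_trans.
rewrite muleA -EFinM exprS powRM ?exprn_ge0 ?(ltW r0)// mulrA.
by rewrite [_ * r `^ _]mulrC powRNK// mul1r.
Qed.

End cone_slices.

Lemma angular_integralE xi : (forall i, 0 <= xi i) -> (forall i, xi i <= 1) ->
  angular_integral xi = (limit_tail nu xi)%:E.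
Proof.
move=> xi0 xi1.
have nuE : nu (ext_tail xi 1) = (limit_tail nu xi)%:E.
  by rewrite (limit_tailE nu_radon nu_real nu_homog)// powR1 mul1r.
have fI : angular_integral xi \is a fin_num.
  rewrite ge0_fin_numE; last first.
    by apply: integral_ge0 => x _; rewrite lee_fin angular_loss_ge0.
  (* Only finiteness is sought here, so any ratio strictly between 0 and 1 serves. *)
  apply: le_lt_trans (angular_le_tail xi0 xi1 (r := 2^-1) _ _) _.
  - by rewrite invr_gt0.
  - by rewrite invf_lt1 ?ltr1n.
  - by rewrite nuE -EFinM ltry.
rewrite -(fineK fI); congr _%:E; apply/eqP; rewrite eq_le; apply/andP; split;
  rewrite leNgt; apply/negP => lt; near (1 : R)^'- => r;
  (have r0 : 0 < r by near: r; exact: nbhs_left_gt);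
  (have r1 : r < 1 by near: r; exact: nbhs_left_lt).
- have := angular_le_tail xi0 xi1 r0 r1.
  rewrite nuE -(fineK fI) -EFinM lee_fin; apply/negP; rewrite -ltNge.
  by near: r; exact: powR_scaled_lt.
- have := tail_le_angular xi0 xi1 r0 r1.
  rewrite nuE -(fineK fI) -EFinM lee_fin; apply/negP; rewrite -ltNge.
  by near: r; exact: powR_scaled_lt.
Unshelve. all: end_near. Qed.

(** Margins are treated as losses of these one-component portfolios, so that the results on losses
    cover them. *)
Definition unit_weight (i : 'I_d) : 'I_d -> R := fun j => (j == i)%:R.

Lemma ext_loss_unit i x : ext_loss (unit_weight i) x = `|fine (x ord0 i)|.
Proof.
rewrite /ext_loss (bigD1 i)//= /unit_weight eqxx mul1r big1 ?addr0// => j ji.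
by rewrite (negbTE ji) mul0r.
Qed.

Lemma angular_integral_sum (lam : 'I_d -> R) : (forall i, 0 <= lam i) ->
  (\int[nu]_(x in D)
     (\sum_(i < d) lam i * angular_loss (unit_weight i) x)%:E)%E =
  (\sum_(i < d) lam i * limit_tail nu (unit_weight i))%:E.
Proof.
move=> lam0; under eq_integral do rewrite -sumEFin.
rewrite ge0_integral_sum//.
- rewrite -sumEFin; apply: eq_bigr => i _.
  under eq_integral do rewrite EFinM.
  rewrite ge0_integralZl//.
  + rewrite EFinM -angular_integralE// => j.
    by rewrite /unit_weight lern1 leq_b1.
  + exact: angular_loss_measurable.
  + by move=> x _; rewrite lee_fin angular_loss_ge0.
  + by rewrite lee_fin.
- move=> i; under eq_fun do rewrite EFinM.
  apply: measurable_funeM; exact: angular_loss_measurable.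
- by move=> i x _; rewrite lee_fin mulr_ge0// angular_loss_ge0.
Qed.

Lemma angular_sum_measurable (lam : 'I_d -> R) : measurable_fun D
  (fun x => (\sum_(i < d) lam i * angular_loss (unit_weight i) x)%:E).
Proof.
apply/measurable_EFinP; apply: measurable_sum => i; apply: measurable_funM => //.
by apply/measurable_EFinP; exact: angular_loss_measurable.
Qed.

Lemma angular_sumE (lam : 'I_d -> R) x :
  \sum_(i < d) lam i * angular_loss (unit_weight i) x =
  (\sum_(i < d) lam i * `|fine (x ord0 i)| `^ alpha) * M x `^ (- alpha).
Proof.
rewrite mulr_suml; apply: eq_bigr => i _.
by rewrite /angular_loss ext_loss_unit mulrA.
Qed.

(** Both sides are integrals over $\{M > 1\}$ with the factor $M^{-\alpha}$, so a pointwise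
    inequality is enough. The coefficients [lam] will be either the weights or their powers of
    exponent [alpha]. *)
Lemma limit_tail_le (xi lam : 'I_d -> R) :
  (forall i, 0 <= xi i) -> (forall i, xi i <= 1) -> (forall i, 0 <= lam i) ->
  (forall u : 'I_d -> R, (forall i, 0 <= u i) ->
    (\sum_(i < d) xi i * u i) `^ alpha <= \sum_(i < d) lam i * u i `^ alpha) ->
  limit_tail nu xi <= \sum_(i < d) lam i * limit_tail nu (unit_weight i).
Proof.
move=> xi0 xi1 lam0 xilam.
rewrite -lee_fin -angular_integralE// -angular_integral_sum//.
apply: ge0_le_integral => //.
- by move=> x _; rewrite lee_fin angular_loss_ge0.
- exact: angular_loss_measurable.
- exact: angular_sum_measurable.
- by move=> x _; rewrite lee_fin angular_sumE ler_wpM2r ?powR_ge0// xilam.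
Qed.

Lemma limit_tail_ge (xi lam : 'I_d -> R) :
  (forall i, 0 <= xi i) -> (forall i, xi i <= 1) -> (forall i, 0 <= lam i) ->
  (forall u : 'I_d -> R, (forall i, 0 <= u i) ->
    \sum_(i < d) lam i * u i `^ alpha <= (\sum_(i < d) xi i * u i) `^ alpha) ->
  \sum_(i < d) lam i * limit_tail nu (unit_weight i) <= limit_tail nu xi.
Proof.
move=> xi0 xi1 lam0 xilam.
rewrite -lee_fin -angular_integralE// -angular_integral_sum//.
apply: ge0_le_integral => //.
- move=> x _; rewrite lee_fin; apply: sumr_ge0 => i _.
  by rewrite mulr_ge0// angular_loss_ge0.
- exact: angular_sum_measurable.
- exact: angular_loss_measurable.
- by move=> x _; rewrite lee_fin angular_sumE ler_wpM2r ?powR_ge0// xilam.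
Qed.

End spectral.

(** * Power inequalities *)

Section power_inequalities.
Variables (R : realType) (d : nat).
Implicit Types (p t : R) (xi u v : 'I_d -> R).

(* Young's inequality for [t] and [1]. *)
Lemma powR_ge_tangent p t : 1 <= p -> 0 <= t -> 1 + p * (t - 1) <= t `^ p.
Proof.
rewrite le_eqVlt => /predU1P[<- t0|p1 t0].
  by rewrite powRr1// mul1r subrKC.
have p0 : 0 < p by exact: lt_trans p1.
have q0 : 0 < (1 - p^-1)^-1 by rewrite invr_gt0 subr_gt0 invf_lt1.
have := conjugate_powR t0 ler01 p0 q0.
rewrite invrK subrKC powR1 mulr1 mul1r => /(_ erefl).
rewrite -(ler_pM2l p0) mulrDr mulrCA divff ?gt_eqF// mulr1 mulrBr divff ?gt_eqF//.
by move=> h; rewrite mulrBr !mulr1; lra.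
Qed.

(** This is the convex case for the exponent $1/p$, applied to $t^p$. *)
Lemma powR_le_tangent p t : 0 < p -> p <= 1 -> 0 <= t ->
  t `^ p <= 1 + p * (t - 1).
Proof.
move=> p0 p1 t0.
have := @powR_ge_tangent p^-1 (t `^ p) _ (powR_ge0 _ _).
rewrite -powRrM divff ?gt_eqF// powRr1// invf_ge1// => /(_ p1).
rewrite -(ler_pM2l p0) mulrDr mulrA divff ?gt_eqF// mul1r mulr1 => h.
by rewrite mulrBr mulr1; lra.
Qed.

Lemma powR_sum_scale p v (lam : 'I_d -> R) (m : R) : 0 < m -> (forall i, 0 <= v i) ->
  \sum_(i < d) lam i * v i `^ p = (\sum_(i < d) lam i * (v i / m) `^ p) * m `^ p.
Proof.
move=> m0 v0; rewrite mulr_suml; apply: eq_bigr => i _.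
by rewrite -mulrA -powRM ?divfK ?gt_eqF ?divr_ge0// ltW.
Qed.

Lemma sum_weighted_eq0 v : (forall i, 0 <= v i) -> \sum_(i < d) v i <= 0 ->
  forall i, v i = 0.
Proof.
move=> v0 sv i; apply/eqP; rewrite eq_le v0 andbT; apply: le_trans sv.
by rewrite (bigD1 i)//= lerDl; apply: sumr_ge0.
Qed.

(** After division by the mean [m], the tangent inequality at 1 is averaged; the linear terms cancel
    because the weighted mean of [u i / m] is 1. *)
Lemma powR_jensen p xi u : 1 <= p -> (forall i, 0 <= xi i) ->
  \sum_(i < d) xi i = 1 -> (forall i, 0 <= u i) ->
  (\sum_(i < d) xi i * u i) `^ p <= \sum_(i < d) xi i * u i `^ p.
Proof.
move=> p1 xi0 xi1 u0; have p0 : 0 < p by exact: lt_le_trans p1.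
set m := \sum_(i < d) _; have [m0|m0] := leP m 0.
  have -> : m = 0 by apply/eqP; rewrite eq_le m0 sumr_ge0// => i _; rewrite mulr_ge0.
  rewrite powR0 ?gt_eqF//; apply: sumr_ge0 => i _.
  by rewrite mulr_ge0// powR_ge0.
rewrite (powR_sum_scale _ _ m0)// -[leLHS]mul1r ler_wpM2r ?powR_ge0//.
rewrite [leLHS](_ : 1 = \sum_(i < d) xi i * (1 + p * (u i / m - 1))); last first.
  under eq_bigr do rewrite mulrDr mulr1 mulrCA mulrBr mulr1 mulrA.
  rewrite big_split/= -mulr_sumr sumrB -mulr_suml -/m xi1 divff ?gt_eqF//.
  by rewrite subrr mulr0 addr0.
apply: ler_sum => i _; rewrite ler_wpM2l// powR_ge_tangent// divr_ge0// ltW//.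
Qed.

Lemma powR_jensen_concave p xi u : 0 < p -> p <= 1 -> (forall i, 0 <= xi i) ->
  \sum_(i < d) xi i = 1 -> (forall i, 0 <= u i) ->
  \sum_(i < d) xi i * u i `^ p <= (\sum_(i < d) xi i * u i) `^ p.
Proof.
move=> p0 p1 xi0 xi1 u0.
set m := \sum_(i < d) xi i * u i; have [m0|m0] := leP m 0.
  rewrite big1 ?powR_ge0// => i _.
  have /eqP := sum_weighted_eq0 (fun i => mulr_ge0 (xi0 i) (u0 i)) m0 i.
  rewrite mulf_eq0 => /orP[/eqP->|/eqP->]; first by rewrite mul0r.
  by rewrite powR0 ?mulr0// gt_eqF.
rewrite (powR_sum_scale _ _ m0)// -[leRHS]mul1r ler_wpM2r ?powR_ge0//.
rewrite [leRHS](_ : 1 = \sum_(i < d) xi i * (1 + p * (u i / m - 1))); last first.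
  under eq_bigr do rewrite mulrDr mulr1 mulrCA mulrBr mulr1 mulrA.
  rewrite big_split/= -mulr_sumr sumrB -mulr_suml -/m xi1 divff ?gt_eqF//.
  by rewrite subrr mulr0 addr0.
apply: ler_sum => i _; rewrite ler_wpM2l// powR_le_tangent// divr_ge0// ltW//.
Qed.

(** The quotients [v i / m] lie in $[0, 1]$, where a power of exponent at least 1 is below the
    identity, and they sum to 1. *)
Lemma powR_superadditive p v : 1 <= p -> (forall i, 0 <= v i) ->
  \sum_(i < d) v i `^ p <= (\sum_(i < d) v i) `^ p.
Proof.
move=> p1 v0; have p0 : 0 < p by exact: lt_le_trans p1.
set m := \sum_(i < d) v i; have [m0|m0] := leP m 0.
  rewrite big1 ?powR_ge0// => i _.
  by rewrite (sum_weighted_eq0 v0 m0) powR0 ?gt_eqF.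
have := @powR_sum_scale p v (fun=> 1) m m0 v0.
under eq_bigr do rewrite mul1r; move=> ->.
rewrite -[leRHS]mul1r ler_wpM2r ?powR_ge0//.
rewrite [leRHS](_ : 1 = \sum_(i < d) v i / m); last first.
  by rewrite -mulr_suml divff ?gt_eqF.
apply: ler_sum => i _; rewrite mul1r.
have [->|vi0] := eqVneq (v i) 0; first by rewrite mul0r powR0 ?gt_eqF.
rewrite ge1r_powR//; apply/andP; split; first by rewrite divr_gt0// lt_def vi0 v0.
by rewrite ler_pdivrMr// mul1r /m (bigD1 i)//= lerDl; apply: sumr_ge0.
Qed.

Lemma powR_subadditive p v : 0 < p -> p <= 1 -> (forall i, 0 <= v i) ->
  (\sum_(i < d) v i) `^ p <= \sum_(i < d) v i `^ p.
Proof.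
move=> p0 p1 v0.
set m := \sum_(i < d) v i; have [m0|m0] := leP m 0.
  have -> : m = 0 by apply/eqP; rewrite eq_le m0 sumr_ge0.
  by rewrite powR0 ?gt_eqF//; apply: sumr_ge0 => i _; exact: powR_ge0.
have := @powR_sum_scale p v (fun=> 1) m m0 v0.
under eq_bigr do rewrite mul1r; move=> ->.
rewrite -[leLHS]mul1r ler_wpM2r ?powR_ge0//.
rewrite [leLHS](_ : 1 = \sum_(i < d) v i / m); last first.
  by rewrite -mulr_suml divff ?gt_eqF.
apply: ler_sum => i _; rewrite mul1r.
have [->|vi0] := eqVneq (v i) 0; first by rewrite mul0r powR_ge0.
rewrite ger1_powR//; apply/andP; split; first by rewrite divr_gt0// lt_def vi0 v0.
by rewrite ler_pdivrMr// mul1r /m (bigD1 i)//= lerDl; apply: sumr_ge0.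
Qed.

End power_inequalities.

(** * Independent margins *)

Lemma measure_sum_cover (dT : measure_display) (T : measurableType dT)
    (R : realType) (P : {measure set T -> \bar R}) (I : finType)
    (A : I -> set T) (B : set T) :
  measurable B -> (forall i, measurable (A i)) ->
  (forall w, B w -> exists i, A i w) -> (P B <= \sum_i P (A i))%E.
Proof.
move=> mB mA BA.
have mU r : measurable (\big[setU/set0]_(i <- r) A i) by exact: bigsetU_measurable.
have Ur r : (P (\big[setU/set0]_(i <- r) A i) <= \sum_(i <- r) P (A i))%E.
  elim: r => [|i r IH]; first by rewrite !big_nil measure0.
  rewrite !big_cons; apply: (le_trans (measureU2 _ (mA i) (mU r))).
  exact: leeD2l.
rewrite -big_enum/=; apply: le_trans (Ur _).
apply: le_measure; rewrite ?inE// => w /BA[i Aw].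
by rewrite -bigcup_seq; exists i => //=; rewrite mem_enum.
Qed.

Lemma measure_sum_disjoint (dT : measure_display) (T : measurableType dT)
    (R : realType) (P : {measure set T -> \bar R}) (I : finType)
    (A : I -> set T) (B : set T) :
  measurable B -> (forall i, measurable (A i)) -> trivIset setT A ->
  (forall i, A i `<=` B) -> (\sum_i P (A i) <= P B)%E.
Proof.
move=> mB mA tA AB.
have -> : (\sum_i P (A i) = P (\bigcup_i A i))%E.
  rewrite measure_fin_bigcup//; last exact: finite_finset.
  rewrite -big_enum/= fsbig_seq ?enum_uniq//=; apply: eq_fsbigl.
  by apply/seteqP; split => i //= _; rewrite mem_enum.
apply: le_measure; rewrite ?inE//.
  by apply: fin_bigcup_measurable => //; exact: finite_finset.
by move=> w [i _ Aw]; exact: AB Aw.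
Qed.

Section one_big_jump.
Context {dT : measure_display} {T : measurableType dT} {R : realType}.
Context {P : probability T R} {d : nat}.
Variable Y : 'I_d -> {RV P >-> R}.
Variable F : probability (measurableTypeR R) R.
Hypothesis Y_indep : independent_margins Y.
Hypothesis Y_law : forall i, has_law (Y i) F.
Hypothesis F_ge0 : F [set y | y < 0] = 0%E.

Definition scaled_tail (s t : R) : R := fine (F [set y | t < s * y]).

Lemma scaled_gt_measurable (s t : R) :
  measurable ([set y | t < s * y] : set (measurableTypeR R)).
Proof.
rewrite -[X in measurable X]setTI.
have mc : measurable_fun [set: R] (cst t) by [].
have ms : measurable_fun [set: R] (fun y => s * y) by exact: mulrl_measurable.
exact: (measurable_fun_ltr mc ms measurableT (Y := [set true])).
Qed.

Lemma margin_measurable i (A : set R) :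
  measurable A -> measurable [set w | A (Y i w)].
Proof. by move=> mA; rewrite -[X in measurable X]setTI; exact: measurable_funP. Qed.

Lemma scaled_tailE i s t : P [set w | t < s * Y i w] = (scaled_tail s t)%:E.
Proof.
have m := scaled_gt_measurable s t.
rewrite fineK ?fin_num_measure//; exact: (Y_law i m).
Qed.

Lemma scaled_tail_ge0 s t : 0 <= scaled_tail s t.
Proof. by rewrite fine_ge0. Qed.

Lemma margin_gt_measurable i s t : measurable [set w | t < s * Y i w].
Proof. exact: (margin_measurable i (scaled_gt_measurable s t)). Qed.

Lemma pair_tailE i j s s' t : i != j ->
  P [set w | t < s * Y i w /\ t < s' * Y j w] =
  (scaled_tail s t * scaled_tail s' t)%:E.
Proof.
move=> ij.
pose A k : set R := [set y | t < (if k == i then s else s') * y].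
have := Y_indep (i |: [set j])%SET (A := A) (fun k => scaled_gt_measurable _ t).
rewrite big_setU1 ?inE// big_set1 /A eqxx [j == i]eq_sym (negbTE ij).
rewrite !scaled_tailE EFinM => <-; congr (P _); apply/seteqP; split=> w /=.
  move=> [ti tj] k; rewrite !inE => /orP[/eqP->|/eqP->]; first by rewrite eqxx.
  by rewrite eq_sym (negbTE ij).
move=> h; split; first by have := h i; rewrite !inE eqxx; exact.
by have := h j; rewrite !inE eqxx orbT eq_sym (negbTE ij); exact.
Qed.

Variable xi : 'I_d -> R.
Hypothesis xi0 : forall i, 0 <= xi i.

(** For $b > 0$ and independent margins this bounds the probability that two different terms exceed
    $t / b$ together. Ordered pairs count each event twice, which is harmless for a negligible
    sum. *)
Definition pair_sum (b t : R) : R := \sum_(ij : 'I_d * 'I_d | ij.1 != ij.2)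
  scaled_tail (b * xi ij.1) t * scaled_tail (b * xi ij.2) t.

(* If the total exceeds [t], either one term exceeds [b t], or two terms exceed
   [(1 - b) t / d]: otherwise the total is at most
   [b t + (d - 1) (1 - b) t / d <= t]. *)
Lemma one_big_jump_upper b t : 0 < b -> b < 1 -> 0 < t ->
  loss_tail Y xi t <=
  \sum_(i < d) scaled_tail (xi i / b) t + pair_sum (d%:R / (1 - b)) t.
Proof.
move=> b0 b1 t0; set c := d%:R / (1 - b).
have [d0|d0] := posnP d.
  rewrite [leLHS](_ : _ = 0) ?addr_ge0//.
  - by apply: sumr_ge0 => i _; exact: scaled_tail_ge0.
  - by apply: sumr_ge0 => i _; rewrite mulr_ge0// scaled_tail_ge0.
  - rewrite /loss_tail (_ : mkset _ = set0) ?measure0//.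
    apply/seteqP; split=> w //=; rewrite /portfolio_loss big1 ?ltNge ?ltW//.
    by case=> i id; exfalso; move: id; rewrite d0.
have c0 : 0 < c by rewrite divr_gt0 ?subr_gt0 ?ltr0n.
pose A (k : 'I_d + 'I_d * 'I_d) : set T :=
  match k with
  | inl i => [set w | t < xi i / b * Y i w]
  | inr ij => if ij.1 != ij.2 then
      [set w | t < c * xi ij.1 * Y ij.1 w /\ t < c * xi ij.2 * Y ij.2 w] else set0
  end.
have mA k : measurable (A k).
  case: k => [i|[i j]] /=; first exact: margin_gt_measurable.
  case: ifP => // _.
  by apply: measurableI; exact: margin_gt_measurable.
have cov w : t < portfolio_loss xi Y w -> exists k, A k w.
  move=> tw; apply/not_existsP => nA.
  have small i : xi i * Y i w <= b * t.
    rewrite leNgt; apply/negP => bi; apply: (nA (inl i)).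
    by rewrite /= mulrAC ltr_pdivlMr// mulrC.
  have pair i j : i != j -> t / c < xi i * Y i w -> xi j * Y j w <= t / c.
    move=> ij ti; rewrite leNgt; apply/negP => tj; apply: (nA (inr (i, j))).
    rewrite /= ij /=; split; rewrite -mulrA mulrC -ltr_pdivrMr//.
  have dtc : \sum_(i < d) t / c = (1 - b) * t.
    rewrite sumr_const card_ord -mulr_natr /c invf_div -mulrA divfK 1?mulrC//.
    by rewrite pnatr_eq0 -lt0n.
  have tc0 : 0 <= t / c by rewrite divr_ge0 ?ltW.
  suff : portfolio_loss xi Y w <= t by rewrite leNgt tw.
  have [[i ti]|/forallNP ni] := pselect (exists i, t / c < xi i * Y i w).
    rewrite /portfolio_loss (bigD1 i)//=.
    have -> : t = b * t + \sum_(j < d) t / c by rewrite dtc -mulrDl subrKC mul1r.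
    rewrite lerD// [leRHS](bigD1 i)//=.
    rewrite -[leLHS]add0r lerD//; apply: ler_sum => j ji.
    by apply: (pair i) => //; rewrite eq_sym.
  apply: (@le_trans _ _ ((1 - b) * t)); last by rewrite ler_piMl ?ltW// gtrBl.
  rewrite -dtc; apply: ler_sum => i _.
  by rewrite leNgt; apply/negP; exact: ni.
rewrite -lee_fin loss_tailE.
have := @measure_sum_cover _ _ _ P _ A _ (loss_gt_measurable Y xi t) mA cov.
move/le_trans; apply.
rewrite big_sumType/= EFinD -sumEFin /pair_sum -sumEFin leeD//.
  by apply: lee_sum => i _; rewrite scaled_tailE.
rewrite [leRHS]big_mkcond/=; apply: lee_sum => -[i j] _ /=.
by case: ifP => [ij|_]; [rewrite pair_tailE|rewrite measure0].
Qed.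

(** The events [B i], on which term [i] alone exceeds [t], are disjoint and, up to a null set, imply
    a loss above [t]. Passing from [A i] to [B i] costs at most the pairs containing [i]. *)
Lemma one_big_jump_lower t : 0 < t ->
  \sum_(i < d) scaled_tail (xi i) t - pair_sum 1 t <= loss_tail Y xi t.
Proof.
move=> t0.
pose A i : set T := [set w | t < xi i * Y i w].
pose B i : set T := A i `&` [set w | forall j, j != i -> xi j * Y j w <= t].
have mA i : measurable (A i) by exact: margin_gt_measurable.
have mB i : measurable (B i).
  apply: measurableI => //.
  rewrite (_ : mkset _ = \bigcap_(j in [set j | j != i]) ~` A j).
    apply: fin_bigcap_measurable => [|j _]; first exact: finite_finset.
    exact: measurableC.
  apply/seteqP; split=> w /= h j ji; first by apply/negP; rewrite -leNgt h.
  by have /negP := h j ji; rewrite -leNgt.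
(* Only the law makes [Y] nonnegative, so this holds almost surely and the exceptions are collected
   here. *)
pose N : set T := \bigcup_(i in [set: 'I_d]) [set w | Y i w < 0].
have mlt0 : measurable ([set y | y < 0] : set (measurableTypeR R)).
  rewrite (_ : mkset _ = `]-oo, 0[%classic); first exact: measurable_itv.
  by apply/seteqP; split => y /=; rewrite in_itv.
have mN : measurable N.
  by apply: fin_bigcup_measurable => // i _; exact: (margin_measurable i mlt0).
have N0 : P N = 0%E.
  apply/eqP; rewrite -measure_le0.
  have := @measure_sum_cover _ _ _ P _ (fun i => [set w | Y i w < 0]) N mN
    (fun i => margin_measurable i mlt0).
  rewrite big1; first by apply => w [i _ Yw]; exists i.
  by move=> i _; have := Y_law i mlt0; rewrite F_ge0.
pose E := [set w | t < portfolio_loss xi Y w].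
have mE : measurable E by exact: loss_gt_measurable.
have BE i : B i `<=` E `|` N.
  move=> w [Aw _]; have [Nw|nN] := pselect (N w); [by right|left].
  apply: (lt_le_trans Aw); rewrite /portfolio_loss (bigD1 i)//= lerDl.
  apply: sumr_ge0 => j _; rewrite mulr_ge0// leNgt; apply/negP => Yj.
  by apply: nN; exists j.
have tB : trivIset setT B.
  apply/trivIsetP => i j _ _ ij; apply/seteqP; split=> // w [[Ai _] [_ /(_ i ij)]].
  by rewrite leNgt => /negP; apply.
have AB i : (P (A i) <= P (B i) +
    \sum_(j < d | j != i) (scaled_tail (xi i) t * scaled_tail (xi j) t)%:E)%E.
  pose C (k : 'I_1 + 'I_d) : set T := if k is inr j then
    (if j != i then [set w | t < xi i * Y i w /\ t < xi j * Y j w] else set0)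
    else B i.
  have mC k : measurable (C k).
    case: k => [_|j] //=; case: ifP => // _.
    by apply: measurableI; exact: margin_gt_measurable.
  have cov w : A i w -> exists k, C k w.
    move=> Aw.
    have [[j [ji tj]]|nj] := pselect (exists j, j != i /\ t < xi j * Y j w).
      by exists (inr j); rewrite /= ji.
    exists (inl ord0); split => // j ji; rewrite leNgt; apply/negP => tj.
    by apply: nj; exists j.
  have := @measure_sum_cover _ _ _ P _ C _ (mA i) mC cov.
  move/le_trans; apply.
  rewrite big_sumType/= big_ord1 leeD2l// [leRHS]big_mkcond/=; apply: lee_sum => j _.
  by case: ifP => [ji|_]; [rewrite pair_tailE// eq_sym|rewrite measure0].
rewrite lerBlDr -lee_fin EFinD loss_tailE -/E -(measureU0 mE mN N0).
rewrite -sumEFin.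
apply: (@le_trans _ _ (\sum_i (P (B i) +
    \sum_(j < d | j != i) (scaled_tail (xi i) t * scaled_tail (xi j) t)%:E))%E).
  apply: lee_sum => i _; rewrite -(scaled_tailE i). exact: AB.
rewrite big_split/= leeD//.
  by apply: measure_sum_disjoint => //; exact: measurableU.
rewrite /pair_sum -sumEFin (pair_big_dep xpredT (fun i j => j != i))/=.
rewrite le_eqVlt; apply/orP; left; apply/eqP.
by apply: eq_big => [ij|ij _] /=; rewrite ?mul1r// eq_sym.
Qed.

Variables (alpha : R) (Fb : R -> R).
Hypothesis Fb_gt0 : forall t, 0 < Fb t.
Hypothesis Fb_cvg0 : Fb t @[t --> +oo] --> 0.
Hypothesis scaled_lim : forall s, 0 <= s ->
  scaled_tail s t / Fb t @[t --> +oo] --> s `^ alpha.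

Lemma sum_scaled_lim (s : 'I_d -> R) : (forall i, 0 <= s i) ->
  (\sum_(i < d) scaled_tail (s i) t) / Fb t @[t --> +oo] -->
  \sum_(i < d) s i `^ alpha.
Proof.
move=> s0; under eq_fun do rewrite mulr_suml.
apply: (@cvg_big _ _ +%R 0 xpredT (@add_continuous R) _ _ _ _ _ _) => i _.
exact: scaled_lim.
Qed.

(** A product of two scaled tails is at most of the order of the square of [Fb]. *)
Lemma pair_sum_lim b : 0 <= b -> pair_sum b t / Fb t @[t --> +oo] --> 0.
Proof.
move=> b0.
have <- : \sum_(ij : 'I_d * 'I_d | ij.1 != ij.2) (0 : R) = 0 by rewrite big1.
under eq_fun do rewrite mulr_suml.
apply: (@cvg_big _ _ +%R 0 _ (@add_continuous R) _ _ _ _ _ _) => -[i j] _ /=.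
have <- : (b * xi i) `^ alpha * (b * xi j) `^ alpha * 0 = 0 by rewrite mulr0.
rewrite (_ : (fun t => _) = (fun t => (scaled_tail (b * xi i) t / Fb t) *
    (scaled_tail (b * xi j) t / Fb t) * Fb t)).
  apply: cvgM => //; apply: cvgM; apply: scaled_lim; exact: mulr_ge0.
apply/funext => t /=; rewrite mulrACA -[RHS]mulrA; congr (_ * _).
by rewrite -mulrA mulVf ?mulr1// gt_eqF.
Qed.

(** For each fixed $b < 1$ the pairs are negligible, and the single jumps of the upper estimate cost
    a factor $b^{-\alpha}$, which tends to 1 with $b$. *)
Lemma indep_loss_tail_cvg :
  loss_tail Y xi t / Fb t @[t --> +oo] --> \sum_(i < d) xi i `^ alpha.
Proof.
set S := \sum_(i < d) _.
have up y : S < y -> \forall t \near +oo, loss_tail Y xi t / Fb t < y.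
  move=> Sy.
  have [b [b0 b1 bS]] : exists b : R, [/\ 0 < b, b < 1 & b `^ (- alpha) * S < y].
    near (1 : R)^'- => b; exists b; split.
    - by near: b; exact: nbhs_left_gt.
    - by near: b; exact: nbhs_left_lt.
    - by near: b; exact: powR_scaled_lt.
  have c0 : 0 <= d%:R / (1 - b) by rewrite divr_ge0// subr_ge0 ltW.
  have xib i : 0 <= xi i / b by rewrite divr_ge0// ltW.
  have h : (\sum_(i < d) scaled_tail (xi i / b) t) / Fb t +
      pair_sum (d%:R / (1 - b)) t / Fb t @[t --> +oo] --> b `^ (- alpha) * S.
    rewrite -[X in _ --> X]addr0.
    have <- : \sum_(i < d) (xi i / b) `^ alpha = b `^ (- alpha) * S.
      rewrite mulr_sumr; apply: eq_bigr => i _.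
      rewrite powRM ?invr_ge0 ?(ltW b0)// mulrC.
      by rewrite -powR_inv1 ?(ltW b0)// -powRrM mulN1r.
    by apply: cvgD; [exact: sum_scaled_lim|exact: pair_sum_lim].
  have nS := cvgr_lt _ h _ bS; near=> t.
  have t0 : 0 < t by near: t; exact: nbhs_pinfty_gt.
  have ub : (\sum_(i < d) scaled_tail (xi i / b) t) / Fb t +
    pair_sum (d%:R / (1 - b)) t / Fb t < y by near: t; exact: nS.
  apply: le_lt_trans ub; rewrite -mulrDl ler_wpM2r ?invr_ge0 ?(ltW (Fb_gt0 t))//.
  exact: one_big_jump_upper.
have low y : y < S -> \forall t \near +oo, y < loss_tail Y xi t / Fb t.
  move=> yS.
  have h : (\sum_(i < d) scaled_tail (xi i) t) / Fb t - pair_sum 1 t / Fb t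
      @[t --> +oo] --> S.
    rewrite -[X in _ --> X]subr0.
    by apply: cvgB; [exact: sum_scaled_lim|exact: pair_sum_lim].
  have nS := cvgr_gt _ h _ yS; near=> t.
  have t0 : 0 < t by near: t; exact: nbhs_pinfty_gt.
  have lb : y < (\sum_(i < d) scaled_tail (xi i) t) / Fb t - pair_sum 1 t / Fb t.
    by near: t; exact: nS.
  apply: (lt_le_trans lb); rewrite -mulrBl ler_wpM2r ?invr_ge0 ?(ltW (Fb_gt0 t))//.
  exact: one_big_jump_lower.
apply/cvgrPdist_lt => e e0.
near=> t; rewrite distrC ltr_distl; apply/andP; split.
  by near: t; apply: low; rewrite gtrBl.
by near: t; apply: up; rewrite ltrDl.
Unshelve. all: end_near. Qed.

End one_big_jump.

(** * Comparison of the tails *)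

Lemma simplex_le1 (R : realType) (d : nat) (xi : 'I_d -> R) :
  simplex xi -> forall i, xi i <= 1.
Proof.
by move=> [xi0 <-] i; rewrite (bigD1 i)//= lerDl; apply: sumr_ge0.
Qed.

Lemma loss_tail_scale (dT : measure_display) (T : measurableType dT)
    (R : realType) (P : probability T R) (d : nat) (X : 'I_d -> {RV P >-> R})
    (xi : 'I_d -> R) (s t : R) :
  0 < s -> loss_tail X (fun i => s^-1 * xi i) t = loss_tail X xi (s * t).
Proof.
move=> s0; congr (fine (P _)); apply/funext => w /=.
rewrite /portfolio_loss; under eq_bigr do rewrite -mulrA.
by rewrite -mulr_sumr mulrC ltr_pdivlMr// mulrC.
Qed.

Lemma loss_tail_unit (dT : measure_display) (T : measurableType dT)
    (R : realType) (P : probability T R) (d : nat) (X : 'I_d -> {RV P >-> R})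
    (F : probability (measurableTypeR R) R) (i : 'I_d) (s : R) :
  has_law (X i) F ->
  loss_tail X (fun j => s * unit_weight R i j) = scaled_tail F s.
Proof.
move=> XF; apply/funext => t.
rewrite /scaled_tail -XF; last exact: scaled_gt_measurable.
congr (fine (P _)); apply/funext => w /=.
rewrite /portfolio_loss (bigD1 i)//= /unit_weight eqxx mulr1 big1 ?addr0// => j ji.
by rewrite (negbTE ji) mulr0 mul0r.
Qed.

Lemma loss_tail_comonotone (dT : measure_display) (T : measurableType dT)
    (R : realType) (P : probability T R) (d : nat) (Z : 'I_d -> {RV P >-> R})
    (F : probability (measurableTypeR R) R) (i0 : 'I_d) (xi : 'I_d -> R) :
  (forall i, {ae P, forall w, Z i w = Z i0 w}) -> has_law (Z i0) F ->
  \sum_(i < d) xi i = 1 -> loss_tail Z xi = scaled_tail F 1.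
Proof.
move=> Zae ZF xi1; apply/funext => t.
rewrite /scaled_tail -ZF; last exact: scaled_gt_measurable.
congr fine.
have mE := loss_gt_measurable Z xi t.
have mG : measurable [set w | t < 1 * Z i0 w] by exact: margin_gt_measurable.
have [N [mN N0 ZN]] := filter_forall _ Zae.
have ZeqN w : ~ N w -> portfolio_loss xi Z w = 1 * Z i0 w.
  move=> nN; rewrite -xi1 mulr_suml; apply: eq_bigr => i _; congr (_ * _).
  by apply: contrapT => h; apply: nN; apply: ZN => /= ZZ; exact: h (ZZ i).
rewrite -[RHS]/(P [set w | t < 1 * Z i0 w]).
apply/eqP; rewrite eq_le; apply/andP; split.
- rewrite -[leRHS](measureU0 mG mN N0); apply: le_measure; rewrite ?inE//.
    exact: measurableU.
  move=> w /= tw; have [|nN] := pselect (N w); first by right.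
  by left; rewrite /= -ZeqN.
- rewrite -(measureU0 mE mN N0); apply: le_measure; rewrite ?inE//.
    exact: measurableU.
  move=> w /= tw; have [|nN] := pselect (N w); first by right.
  by left; rewrite /= ZeqN.
Qed.

(** The denominator of the order uses $\ge t$ and so is at least the strict tail; the ratio of
    strict tails suffices. The positive limit [gY] makes denominators eventually positive, out of
    reach of the conventions on division by 0. *)
Lemma apl_le_ratio (R : realType) (dX dY : measure_display)
    (TX : measurableType dX) (TY : measurableType dY)
    (PX : probability TX R) (PY : probability TY R) (d : nat)
    (X : 'I_d -> {RV PX >-> R}) (Y : 'I_d -> {RV PY >-> R})
    (Fb : R -> R) (gX gY : ('I_d -> R) -> R) :
  (forall t, 0 < Fb t) ->
  (forall xi, simplex xi -> loss_tail X xi t / Fb t @[t --> +oo] --> gX xi) ->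
  (forall xi, simplex xi -> loss_tail Y xi t / Fb t @[t --> +oo] --> gY xi) ->
  (forall xi, simplex xi -> 0 < gY xi) ->
  (forall xi, simplex xi -> gX xi <= gY xi) ->
  apl_le X Y.
Proof.
move=> Fb0 Xlim Ylim gY0 gXY xi sxi; apply/lee_addgt0Pr => e e0.
have lim : loss_tail X xi t / Fb t / (loss_tail Y xi t / Fb t) @[t --> +oo]
    --> gX xi / gY xi.
  by apply: cvgM; [exact: Xlim|apply: cvgV; [rewrite gt_eqF// gY0|exact: Ylim]].
have ratio1 : gX xi / gY xi < 1 + e.
  by rewrite ltr_pdivrMr ?gY0// (le_lt_trans (gXY _ sxi))// ltr_pMl ?gY0// ltrDl.
pose V := [set t | loss_tail X xi t / Fb t / (loss_tail Y xi t / Fb t) < 1 + e /\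
  0 < loss_tail Y xi t / Fb t].
have nV : \forall t \near +oo, V t.
  near=> t; split; near: t.
    exact: (cvgr_lt _ lim).
  exact: (cvgr_gt _ (Ylim _ sxi) _ (gY0 _ sxi)).
(* The upper limit is an infimum, over the sets of the filter, of suprema; [V] is the set chosen. *)
apply: ge_ereal_inf; eexists; first by exists V.
apply: ge_ereal_sup => _ [t [tR tY] <-]; rewrite /tail_ratio.
have lY : 0 < loss_tail Y xi t by move: tY; rewrite pmulr_lgt0// invr_gt0.
have mge : measurable [set w | t <= portfolio_loss xi Y w].
  rewrite -[X in measurable X]setTI.
  rewrite (_ : mkset _ = portfolio_loss xi Y @^-1` `[t, +oo[%classic).
    by apply: portfolio_loss_measurable => //; exact: measurable_itv.
  by apply/seteqP; split => x /=; rewrite in_itv/= andbT.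
have fY : PY [set w | t <= portfolio_loss xi Y w] \is a fin_num.
  by rewrite fin_num_measure.
set b := fine (PY [set w | t <= portfolio_loss xi Y w]).
have YE : PY [set w | t <= portfolio_loss xi Y w] = b%:E by rewrite fineK.
have lb : loss_tail Y xi t <= b.
  rewrite -lee_fin -YE loss_tailE; apply: le_measure; rewrite ?inE//.
    exact: loss_gt_measurable.
  by move=> w /= /ltW.
have b0 : 0 < b by exact: lt_le_trans lb.
rewrite YE -loss_tailE eqe gt_eqF// inver gt_eqF// -EFinM lee_fin.
move: tR; rewrite -mulf_div divff ?mulr1; last by rewrite gt_eqF// invr_gt0.
move=> /ltW; apply: le_trans; rewrite ler_wpM2l ?loss_tail_ge0//.
by rewrite lef_pV2.
Unshelve. all: end_near. Qed.

(** * Regularly varying vectors with identically distributed margins *)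

Section mrv_tails.
Context {dT : measure_display} {T : measurableType dT} {R : realType}.
Context {P : probability T R} {d : nat}.
Variable X : 'I_d -> {RV P >-> R}.
Variable F : probability (measurableTypeR R) R.
Variables (alpha : R) (a : nat -> R).
Variable nu : {measure set (ext_space R d) -> \bar R}.
Hypothesis X_ge0 : forall w i, 0 <= X i w.
Hypothesis X_law : forall i, has_law (X i) F.
Hypothesis alpha0 : 0 < alpha.
Hypothesis a_cvg : a @ \oo --> +oo.
Hypothesis nu_radon : punctured_radon nu.
Hypothesis nu_neq0 : nu setT != 0%E.
Hypothesis nu_real : nu (~` @ext_real R d) = 0%E.
Hypothesis nu_homog : forall (t : R) (A : set (ext_space R d)), 0 < t ->
  measurable A -> ~ closure (A : set 'rV[\bar R]_d) (@ext0 R d) ->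
  nu (ext_scale t @` A) = ((t `^ (- alpha))%:E * nu A)%E.
Hypothesis nu_lim : punctured_vague_cvg
  (fun n A => (n%:R%:E * P [set w | A (rescaled X (a n) w)])%E) nu.

Lemma limit_tail_scale xi s : (forall i, 0 <= xi i) -> 0 < s ->
  limit_tail nu (fun i => s^-1 * xi i) = s `^ (- alpha) * limit_tail nu xi.
Proof.
move=> xi0 s0; apply: EFin_inj; rewrite -(limit_tailE nu_radon nu_real nu_homog)//.
have sxi0 i : 0 <= s^-1 * xi i by rewrite mulr_ge0// invr_ge0 ltW.
have := limit_tailE nu_radon nu_real nu_homog sxi0 ltr01.
rewrite powR1 mul1r => <-.
congr (nu _); apply/funext => x; rewrite /ext_tail/= /ext_loss.
under eq_bigr do rewrite -mulrA.
by rewrite -mulr_sumr mulrC ltr_pdivlMr// mul1r.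
Qed.

Lemma scaled_tail_cvg xi s : (forall i, 0 <= xi i) -> 0 < s ->
  n%:R * loss_tail X xi (s * a n) @[n --> \oo] --> s `^ (- alpha) * limit_tail nu xi.
Proof.
move=> xi0 s0; rewrite -limit_tail_scale//.
under eq_fun do rewrite -loss_tail_scale//.
apply: (tail_cvg X_ge0 a_cvg nu_radon nu_real nu_homog nu_lim) => i.
by rewrite mulr_ge0// invr_ge0 ltW.
Qed.

Lemma unit_ge0 i : forall j, 0 <= unit_weight R (d := d) i j.
Proof. by move=> j; rewrite /unit_weight ler0n. Qed.

Lemma loss_tail_unit1 i : loss_tail X (unit_weight R i) = scaled_tail F 1.
Proof.
rewrite -(loss_tail_unit 1 (X_law i)); congr loss_tail.
by apply/funext => j; rewrite mul1r.
Qed.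

Lemma limit_tail_unit i j :
  limit_tail nu (unit_weight R i) = limit_tail nu (unit_weight R j).
Proof.
have h k := tail_cvg X_ge0 a_cvg nu_radon nu_real nu_homog nu_lim (@unit_ge0 k).
apply: (cvg_unique _ (h i)) => //.
by have := h j; rewrite !loss_tail_unit1.
Qed.

(* All margins have the same tail, so if one of these values vanished, all would,
   and [nu] would be carried by the origin and the infinite vectors. *)
Lemma limit_tail_unit_gt0 i : 0 < limit_tail nu (unit_weight R i).
Proof.
rewrite lt_def limit_tail_ge0 andbT; apply/negP => /eqP ci.
have z j s : 0 < s -> nu (ext_tail (unit_weight R j) s) = 0%E.
  move=> s0; rewrite (limit_tailE nu_radon nu_real nu_homog (@unit_ge0 j))//.
  by rewrite (limit_tail_unit j i) ci mulr0.
pose A (k : 'I_1 + ('I_1 + 'I_d)) : set (ext_space R d) :=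
  match k with
  | inl _ => [set @ext0 R d]
  | inr (inl _) => ~` @ext_real R d
  | inr (inr j) => \bigcup_n ext_tail (unit_weight R j) n.+1%:R^-1
  end.
have mA k : measurable (A k).
  case: k => [_|[_|j]] /=.
  (* The singleton of the origin is Borel, being the set of finite points of zero l1-norm. *)
  - rewrite (_ : [set _] = @ext_real R d `\` ext_tail (fun=> 1) 0).
      by apply: measurableD; [exact: ext_real_measurable|exact: ext_tail_measurable].
    apply/seteqP; split=> x /=.
      move=> ->; split; first by move=> j; rewrite mxE.
      rewrite /ext_tail/= /ext_loss big1 ?ltxx// => j _.
      by rewrite mxE normr0 mulr0.
    move=> [xr /negP]; rewrite -leNgt /ext_loss => x0.
    apply/rowP => j; rewrite mxE -(fineK (xr j)); congr _%:E.
    apply/eqP; rewrite -normr_eq0 -(mul1r `|_|); apply/eqP.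
    by apply: (sum_weighted_eq0 _ x0) => k; rewrite mul1r.
  - by apply: measurableC; exact: ext_real_measurable.
  - by apply: bigcup_measurable => n _; exact: ext_tail_measurable.
have A0 k : nu (A k) = 0%E.
  case: k => [_|[_|j]] //=; first by have [] := nu_radon.
  apply/negligibleP; first exact: (mA (inr (inr j))).
  apply: negligible_bigcup => n; apply/negligibleP; first exact: ext_tail_measurable.
  by apply: z; rewrite invr_gt0.
have cov (x : ext_space R d) : setT x -> exists k, A k x.
  move=> _; have [xr|] := pselect (ext_real x); last by exists (inr (inl ord0)).
  have [[j xj]|nj] := pselect (exists j, 0 < `|fine (x ord0 j)|).
    have [n _ xn] := near_infty_natSinv_lt (PosNum xj).
    exists (inr (inr j)), n => //; rewrite /ext_tail/= ext_loss_unit.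
    exact: (xn n (leqnn n)).
  exists (inl ord0); apply/rowP => j; rewrite mxE -(fineK (xr j)); congr _%:E.
  apply/eqP; rewrite -normr_le0 leNgt; apply/negP => xj.
  by apply: nj; exists j.
move/eqP: nu_neq0; apply; apply/eqP; rewrite -measure_le0.
have := @measure_sum_cover _ _ _ nu _ A setT measurableT mA cov.
by rewrite big1.
Qed.

Variable i0 : 'I_d.
Let c := limit_tail nu (unit_weight R i0).

Lemma margin_tail_gt0 t : 0 < scaled_tail F 1 t.
Proof.
rewrite -(loss_tail_unit1 i0).
apply: (tail_gt0 (limit_tail_unit_gt0 i0) a_cvg); first exact: loss_tail_nincr.
by move=> s s0; apply: scaled_tail_cvg => //; exact: unit_ge0.
Qed.

Lemma margin_tail_cvg0 : scaled_tail F 1 t @[t --> +oo] --> 0.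
Proof.
apply/cvgrPdist_lt => e e0; rewrite -(loss_tail_unit1 i0).
have F_lim s : 0 < s -> n%:R * loss_tail X (unit_weight R i0) (s * a n) @[n --> \oo]
    --> s `^ (- alpha) * c.
  by move=> s0; apply: scaled_tail_cvg => //; exact: unit_ge0.
have := tail_cvg0 (loss_tail_nincr X (unit_weight R i0)) F_lim e0.
apply: filterS => t te; rewrite sub0r normrN ger0_norm//.
exact: loss_tail_ge0.
Qed.

Lemma loss_tail_ratio xi : (forall i, 0 <= xi i) ->
  loss_tail X xi t / scaled_tail F 1 t @[t --> +oo] --> limit_tail nu xi / c.
Proof.
move=> xi0; rewrite -(loss_tail_unit1 i0).
apply: (tail_ratio_cvg alpha0 (limit_tail_unit_gt0 i0) a_cvg).
- exact: loss_tail_nincr.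
- exact: loss_tail_nincr.
- exact: loss_tail_ge0.
- by move=> s s0; apply: scaled_tail_cvg => //; exact: unit_ge0.
- by move=> s s0; exact: scaled_tail_cvg.
Qed.

Lemma scaled_tail_ratio s : 0 <= s ->
  scaled_tail F s t / scaled_tail F 1 t @[t --> +oo] --> s `^ alpha.
Proof.
move=> s0; rewrite -(loss_tail_unit s (X_law i0)).
have -> : s `^ alpha = limit_tail nu (fun j => s * unit_weight R i0 j) / c.
  have c0 : c != 0 by rewrite gt_eqF// limit_tail_unit_gt0.
  move: s0; rewrite le_eqVlt => /predU1P[<-|s0].
    rewrite powR0 ?gt_eqF// /limit_tail (_ : ext_tail _ _ = set0) ?measure0 ?mul0r//.
    apply/seteqP; split=> x //=; rewrite /ext_tail/= /ext_loss big1 ?ltNge ?ler01//.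
    by move=> j _; rewrite !mul0r.
  rewrite -[X in limit_tail _ (fun j => X * _)]invrK.
  rewrite (limit_tail_scale (@unit_ge0 i0)) ?invr_gt0//.
  by rewrite mulfK// -powR_inv1 ?(ltW s0)// -powRrM mulN1r opprK.
by apply: loss_tail_ratio => j; rewrite mulr_ge0// unit_ge0.
Qed.

End mrv_tails.

Theorem corollary3p8 (R : realType) (d : nat) (hd : (0 < d)%N)
  (dX dY dZ : measure_display)
  (TX : measurableType dX) (TY : measurableType dY) (TZ : measurableType dZ)
  (PX : probability TX R) (PY : probability TY R) (PZ : probability TZ R)
  (X : 'I_d -> {RV PX >-> R}) (Y : 'I_d -> {RV PY >-> R})
  (Z : 'I_d -> {RV PZ >-> R})
  (F : probability (measurableTypeR R) R) (alpha : R)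
  (X_ge0 : forall w i, 0 <= X i w)
  (X_mrv : mrv X alpha)
  (X_law : forall i, has_law (X i) F)
  (Y_indep : independent_margins Y)
  (Y_law : forall i, has_law (Y i) F)
  (Z_dep : forall i, {ae PZ, forall w, Z i w = Z (Ordinal hd) w})
  (Z_law : has_law (Z (Ordinal hd)) F) :
  (1 <= alpha -> apl_le Y X /\ apl_le X Z) /\
  (0 < alpha <= 1 -> apl_le Z X /\ apl_le X Y).
Proof.
have [alpha0 [a [nu [a_cvg [nu_radon nu_neq0] nu_real nu_lim nu_homog]]]] := X_mrv.
pose i0 := Ordinal hd; pose c := limit_tail nu (unit_weight R i0).
have c0 : 0 < c by exact: (limit_tail_unit_gt0 X_ge0 X_law a_cvg nu_radon nu_neq0
     nu_real nu_homog nu_lim).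
have Fb0 t : 0 < scaled_tail F 1 t.
  exact: (margin_tail_gt0 X_ge0 X_law a_cvg nu_radon nu_neq0
     nu_real nu_homog nu_lim i0).
(* Nonnegativity is transferred from [X] to the common law, and thereby to [Y]. *)
have F_ge0 : F [set y | y < 0] = 0%E.
  have mlt0 : measurable ([set y | y < 0] : set (measurableTypeR R)).
    rewrite (_ : mkset _ = `]-oo, 0[%classic); first exact: measurable_itv.
    by apply/seteqP; split => y /=; rewrite in_itv.
  rewrite -(X_law i0 _ mlt0) -[LHS]/(PX [set w | X i0 w < 0]).
  rewrite (_ : mkset _ = set0) ?measure0//.
  by apply/seteqP; split=> w //=; rewrite ltNge X_ge0.
pose gX xi := limit_tail nu xi / c.
pose gY (xi : 'I_d -> R) := \sum_(i < d) xi i `^ alpha.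
have Xlim xi : simplex xi ->
    loss_tail X xi t / scaled_tail F 1 t @[t --> +oo] --> gX xi.
  move=> [xi0 _].
  exact: (loss_tail_ratio X_ge0 X_law alpha0 a_cvg nu_radon nu_neq0
     nu_real nu_homog nu_lim xi0).
have Ylim xi : simplex xi ->
    loss_tail Y xi t / scaled_tail F 1 t @[t --> +oo] --> gY xi.
  move=> [xi0 _]; apply: (indep_loss_tail_cvg Y_indep Y_law F_ge0 xi0 Fb0).
    exact: (margin_tail_cvg0 X_ge0 X_law a_cvg nu_radon
      nu_real nu_homog nu_lim i0).
  move=> s s0.
  exact: (scaled_tail_ratio X_ge0 X_law alpha0 a_cvg nu_radon nu_neq0
     nu_real nu_homog nu_lim i0 s0).
have Zlim xi : simplex xi ->
    loss_tail Z xi t / scaled_tail F 1 t @[t --> +oo] --> (1 : R).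
  move=> [_ xi1]; rewrite (loss_tail_comonotone Z_dep Z_law xi1).
  by apply: cvg_near_cst; apply: nearW => t; rewrite divff// gt_eqF.
have sumc (lam : 'I_d -> R) :
    \sum_(i < d) lam i * limit_tail nu (unit_weight R i) =
    (\sum_(i < d) lam i) * c.
  rewrite mulr_suml; apply: eq_bigr => i _; congr (_ * _).
  exact: (limit_tail_unit X_ge0 X_law a_cvg nu_radon nu_real nu_homog nu_lim).
have gY_gt0 xi : simplex xi -> 0 < gY xi.
  move=> [xi0 xi1]; rewrite lt_def sumr_ge0 ?andbT; last first.
    by move=> i _; rewrite powR_ge0.
  apply/eqP => gy0.
  have /eqP := xi1; rewrite big1 ?(eq_sym 0) ?oner_eq0// => i _.
  apply: (@powR_eq0_eq0 _ _ alpha).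
  apply: (@sum_weighted_eq0 _ _ (fun i => xi i `^ alpha)) => [j|].
    exact: powR_ge0.
  by rewrite -/(gY xi) gy0.
have gX_le xi (lam : 'I_d -> R) : simplex xi -> (forall i, 0 <= lam i) ->
    (forall u : 'I_d -> R, (forall i, 0 <= u i) ->
      (\sum_(i < d) xi i * u i) `^ alpha <= \sum_(i < d) lam i * u i `^ alpha) ->
    gX xi <= \sum_(i < d) lam i.
  move=> sxi lam0 h; rewrite /gX ler_pdivrMr// -sumc.
  by apply: (limit_tail_le alpha0 nu_radon nu_real nu_homog) => //;
    [exact: sxi.1|exact: simplex_le1].
have gX_ge xi (lam : 'I_d -> R) : simplex xi -> (forall i, 0 <= lam i) ->
    (forall u : 'I_d -> R, (forall i, 0 <= u i) ->
      \sum_(i < d) lam i * u i `^ alpha <= (\sum_(i < d) xi i * u i) `^ alpha) ->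
    \sum_(i < d) lam i <= gX xi.
  move=> sxi lam0 h; rewrite /gX ler_pdivlMr// -sumc.
  by apply: (limit_tail_ge alpha0 nu_radon nu_real nu_homog) => //;
    [exact: sxi.1|exact: simplex_le1].
have powu (xi u : 'I_d -> R) : (forall i, 0 <= xi i) -> (forall i, 0 <= u i) ->
    \sum_(i < d) xi i `^ alpha * u i `^ alpha = \sum_(i < d) (xi i * u i) `^ alpha.
  by move=> xi0 u0; apply: eq_bigr => i _; rewrite powRM.
split=> [alpha1|/andP[_ alpha1]].
- have gYX xi : simplex xi -> gY xi <= gX xi.
    move=> sxi; apply: gX_ge => // [i|u u0]; first exact: powR_ge0.
    rewrite powu//; last exact: sxi.1.
    by apply: powR_superadditive => // i; rewrite mulr_ge0// sxi.1.
  split.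
    apply: (apl_le_ratio Fb0 Ylim Xlim) => // xi sxi.
    by apply: lt_le_trans (gYX _ sxi); exact: gY_gt0.
  apply: (apl_le_ratio Fb0 Xlim Zlim) => // xi sxi.
  (* Writing the limit 1 of [Z] as the sum of the weights selects [lam = xi]. *)
  have [xi0 xi1] := sxi; rewrite -xi1; apply: gX_le => // u u0.
  exact: powR_jensen.
- have gZX xi : simplex xi -> 1 <= gX xi.
    move=> sxi; have [xi0 xi1] := sxi; rewrite -xi1; apply: gX_ge => // u u0.
    exact: powR_jensen_concave.
  split.
    apply: (apl_le_ratio Fb0 Zlim Xlim) => // xi sxi.
    by apply: lt_le_trans (gZX _ sxi).
  apply: (apl_le_ratio Fb0 Xlim Ylim) => // xi sxi.
  have [xi0 xi1] := sxi; apply: gX_le => // [i|u u0]; first exact: powR_ge0.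
  rewrite powu//.
  by apply: powR_subadditive => // i; rewrite mulr_ge0.
Qed.
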